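(* Let $\Lambda_1$ and $\Lambda_2$ be the nuisance tangent spaces, at the truth $(\beta_0,g_0,\eta_0)$ of the proportional likelihood ratio model, with respect to $g(\cdot)$ and $\eta(\cdot)$, respectively. Then, as subsets of $\mathcal{H}$, (i) $\Lambda_1=\{h(Y)-E\{h(Y)\mid X\} : h(Y)\text{ is a } q\text{-dimensional vector-valued function}\}$; (ii) $\Lambda_2=\{\alpha(X) : \alpha(X)\text{ is a } q\text{-dimensional vector-valued function such that } E\{\alpha(X)\}=0\}$.
   Context: Model. $Y$ is a real-valued response and $X$ is an $\mathbb{R}^q$-valued covariate. The proportional likelihood ratio model is the set $\mathcal{P}$ of joint densities $$p_{Y,X}\{y,x;\beta,g(\cdot),\eta(\cdot)\}=\frac{\exp(\beta^T x y)\,g(y)}{\int \exp(\beta^T x y)\,dG(y)}\,\eta(x),$$ where $\beta\in\mathbb{R}^q$ is the parameter of interest, $g$ is a density with respect to a dominating measure $\nu$ with distribution function $G$ (the conditional distribution of $Y$ given $X=0$), and $\eta$ is the density of $X$ with respect to some dominating measure; $g$ and $\eta$ are unrestricted infinite-dimensional nuisance parameters. True values are $\beta_0,g_0,\eta_0$; all expectations and conditional expectations are taken under the true distribution. The standard smoothness and regularity conditions of semiparametric theory are assumed throughout for the model and for parametric submodels (e.g. mean-square differentiability of the root density with respect to the finite-dimensional parameter, finite-variance scores, nonsingular information). Hilbert space. $\mathcal{H}$ is the Hilbert space of all $q$-dimensional (measurable) random functions $a(Y,X)$ with $E\{a(Y,X)\}=0$ and finite variance, with inner product $\langle a_1,a_2\rangle=E(a_1^Ta_2)$.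 Nuisance tangent spaces. A parametric submodel for $g$ is a smooth family $g(\cdot;\gamma)$, $\gamma\in\mathbb{R}^r$, of densities with $g(\cdot;\gamma_0)=g_0$ for some $\gamma_0$; its nuisance score is $S_\gamma(y,x)=\partial_\gamma\log p_{Y,X}\{y,x;\beta_0,g(\cdot;\gamma),\eta_0\}|_{\gamma=\gamma_0}$. $\Lambda_1\subset\mathcal{H}$ is the mean-square closure of the set of all elements $C\,S_\gamma(Y,X)$ over all such parametric submodels and all constant $q\times r$ matrices $C$. $\Lambda_2$ is defined in the same way using parametric submodels $\eta(\cdot;\gamma)$ for $\eta$ with $g=g_0$ fixed. The functions $h$, $\alpha$ are measurable and such that the displayed elements are well defined and belong to $\mathcal{H}$. *)

(* Defs.v *)
From HB Require Import structures.
From mathcomp Require Import all_boot all_order all_algebra.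
From mathcomp Require Import all_classical all_reals all_analysis.

Set Implicit Arguments.
Unset Strict Implicit.
Unset Printing Implicit Defensive.

Import Order.TTheory GRing.Theory Num.Theory.
Import numFieldTopology.Exports numFieldNormedType.Exports.

Local Open Scope classical_set_scope.
Local Open Scope ring_scope.

(* The covariate takes values in R^q, represented by q-tuples because these
   carry the product (= Borel) sigma-algebra; the (q-dimensional) parameters and
   the values of random functions are column vectors. *)
Notation covariate R q := (q.-tuple (measurableTypeR R)).
Notation observation R q := (measurableTypeR R * covariate R q)%type.

Section model.
Context {R : realType} {q : nat}.

Definition measurable_vec {d} {T : measurableType d} {k : nat}
    (f : T -> 'cV[R]_k) : Prop :=
  forall i, measurable_fun setT (fun t => f t i 0).

Definition is_density {d} {T : measurableType d}
    (m : {measure set T -> \bar R}) (f : T -> R) : Prop :=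
  [/\ measurable_fun setT f, (forall t, 0 <= f t) &
      (\int[m]_t (f t)%:E = 1)%E].

Context (nu : {sigma_finite_measure set (measurableTypeR R) -> \bar R})
        (mu : {sigma_finite_measure set (covariate R q) -> \bar R}).

Definition dot (beta : 'cV[R]_q) (x : covariate R q) : R :=
  \sum_(i < q) beta i 0 * tnth x i.

Definition normalizer (beta : 'cV[R]_q) (g : R -> R) (x : covariate R q) :
    \bar R :=
  (\int[nu]_y (expR (dot beta x * y) * g y)%:E)%E.

Definition cond_density (beta : 'cV[R]_q) (g : R -> R)
    (y : R) (x : covariate R q) : R :=
  expR (dot beta x * y) * g y / fine (normalizer beta g x).

Definition joint_density (beta : 'cV[R]_q) (g : R -> R)
    (eta : covariate R q -> R) (z : observation R q) : R :=
  cond_density beta g z.1 z.2 * eta z.2.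

(* The normalizer must be finite on the support of X: otherwise
   [joint_density] is not a density ([fine +oo] is 0). *)
Definition in_model (beta : 'cV[R]_q) (g : R -> R)
    (eta : covariate R q -> R) : Prop :=
  [/\ is_density nu g, is_density mu eta &
      {ae mu, forall x, eta x != 0 -> (normalizer beta g x < +oo)%E}].

(* The conditional expectation E{h(Y) | X = x} under (beta, g): the integral of
   h against the conditional density of Y given X = x. It makes sense as soon
   as h is integrable for this conditional law at almost every x
   ([cond_integrable]); h(Y) itself is not required to be integrable. *)
Definition cond_mean (beta : 'cV[R]_q) (g : R -> R) {k : nat}
    (h : R -> 'cV[R]_k) (x : covariate R q) : 'cV[R]_k :=
  \col_i (\int[nu]_y (h y i 0 * cond_density beta g y x))%R.

Definition cond_integrable (beta : 'cV[R]_q) (g : R -> R) {k : nat}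
    (h : R -> 'cV[R]_k) (x : covariate R q) : Prop :=
  forall i, nu.-integrable setT
    (fun y => (h y i 0 * cond_density beta g y x)%:E).

Context (P : probability (observation R q) R).

Definition has_density (p : observation R q -> R) : Prop :=
  forall A, measurable A -> P A = (\int[nu \x mu]_(z in A) (p z)%:E)%E.

Definition inner {k : nat} (a b : observation R q -> 'cV[R]_k) : \bar R :=
  'E_P[(fun z => ((a z)^T *m b z) 0 0)%R]%E.

(* The elements of the Hilbert space are functions; equality in it is equality
   P-almost everywhere, under which the subsets of [hilbert] below are stable. *)
Definition hilbert {k : nat} : set (observation R q -> 'cV[R]_k) :=
  [set a | [/\ measurable_vec a, (inner a a < +oo)%E &
               forall i, ('E_P[(fun z => a z i 0)%R] = 0)%E]].

Definition ms_closure {k : nat} (A : set (observation R q -> 'cV[R]_k)) :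
    set (observation R q -> 'cV[R]_k) :=
  [set a | hilbert a /\ forall e : R, 0 < e ->
     exists2 b, A b &
       (inner (fun z => a z - b z)%R (fun z => a z - b z)%R < e%:E)%E].

(* Differentiability of [p ^~ z] where [p theta0 z > 0] makes [p ^~ z] positive
   near theta0, so that the logarithm is genuine there. *)
Definition is_score {r : nat} (p : 'cV[R]_r -> observation R q -> R)
    (theta0 : 'cV[R]_r) (S : observation R q -> 'cV[R]_r) : Prop :=
  {ae P, forall z, differentiable (p ^~ z) theta0 /\
     forall i, S z i 0 =
       'D_(delta_mx i 0) (fun theta => ln (p theta z)) theta0}.

Definition diff_in_ms {r : nat} (p : 'cV[R]_r -> observation R q -> R)
    (theta0 : 'cV[R]_r) (S : observation R q -> 'cV[R]_r) : Prop :=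
  forall e : R, 0 < e -> \forall theta \near theta0,
    (\int[nu \x mu]_z
       ((Num.sqrt (p theta z) - Num.sqrt (p theta0 z)
         - 2^-1 * ((theta - theta0)^T *m S z) 0 0 * Num.sqrt (p theta0 z)) ^+ 2)%R%:E
     <= (e * `|theta - theta0| ^+ 2)%:E)%E.

Definition information {r : nat} (S : observation R q -> 'cV[R]_r) : 'M[R]_r :=
  \matrix_(i, j) fine 'E_P[(fun z => (S z *m (S z)^T) i j)%R]%E.

(* The family of densities p is regular at theta0, with score S. *)
Definition regular {r : nat} (p : 'cV[R]_r -> observation R q -> R)
    (theta0 : 'cV[R]_r) (S : observation R q -> 'cV[R]_r) : Prop :=
  [/\ measurable_vec S, is_score p theta0 S, (inner S S < +oo)%E,
      information S \in unitmx & diff_in_ms p theta0 S].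

Context (beta0 : 'cV[R]_q) (g0 : R -> R) (eta0 : covariate R q -> R).

Definition regular_model : Prop :=
  (\forall beta \near beta0, in_model beta g0 eta0) /\
  exists S, regular (fun beta => joint_density beta g0 eta0) beta0 S.

Definition submodel_g {r : nat} (g : 'cV[R]_r -> R -> R) (gamma0 : 'cV[R]_r)
    (S : observation R q -> 'cV[R]_r) : Prop :=
  [/\ forall gamma, in_model beta0 (g gamma) eta0, g gamma0 = g0 &
      regular (fun gamma => joint_density beta0 (g gamma) eta0) gamma0 S].

Definition submodel_eta {r : nat} (eta : 'cV[R]_r -> covariate R q -> R)
    (gamma0 : 'cV[R]_r) (S : observation R q -> 'cV[R]_r) : Prop :=
  [/\ forall gamma, in_model beta0 g0 (eta gamma), eta gamma0 = eta0 &
      regular (fun gamma => joint_density beta0 g0 (eta gamma)) gamma0 S].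

Definition nuisance_scores_g : set (observation R q -> 'cV[R]_q) :=
  [set a | hilbert a /\
     exists (r : nat) (g : 'cV[R]_r -> R -> R) (gamma0 : 'cV[R]_r) S
            (C : 'M[R]_(q, r)),
       submodel_g g gamma0 S /\ {ae P, forall z, a z = C *m S z}].

Definition nuisance_scores_eta : set (observation R q -> 'cV[R]_q) :=
  [set a | hilbert a /\
     exists (r : nat) (eta : 'cV[R]_r -> covariate R q -> R)
            (gamma0 : 'cV[R]_r) S (C : 'M[R]_(q, r)),
       submodel_eta eta gamma0 S /\ {ae P, forall z, a z = C *m S z}].

Definition Lambda1 : set (observation R q -> 'cV[R]_q) :=
  ms_closure nuisance_scores_g.

Definition Lambda2 : set (observation R q -> 'cV[R]_q) :=
  ms_closure nuisance_scores_eta.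

End model.

(* Main.v *)
(* A score for g at the truth is an a.e. limit of difference quotients of
   log p, each of the form s(y) + c(x), and the same shape h(y) + k(x) survives
   mean-square limits: subtracting the value at a well-chosen x0 cancels s and
   leaves a limit of functions of x alone. All members of a submodel for g give
   the same law to X, so these elements have conditional mean 0 given X, which
   forces k(X) = - E{h(Y) | X}; for eta the limit only involves c(x).

   Conversely, if h is bounded then h(Y) - E{h(Y) | X} is the score at w = 0 of
   the densities proportional to g0 (1 + w^T h); restricting w to a subspace
   carrying the information matrix makes the submodel regular. A general h is
   truncated to h_n. The error h - h_n, centred given X, is the L2-closest one
   to 0 among its translates by functions of X, so with psi_n t = t - trunc_n t
   it is at most psi_n(h(Y)) - psi_n(E{h(Y) | X}) in norm. As psi_n is
   1-Lipschitz, this is dominated by h(Y) - E{h(Y) | X}, which is square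
   integrable even when h(Y) is not, and dominated convergence concludes. *)

Require Import Defs.
From HB Require Import structures.
From mathcomp Require Import all_boot all_order all_algebra.
From mathcomp Require Import all_classical all_reals all_analysis measurable_realfun.
From mathcomp Require Import ring lra.

Set Implicit Arguments.
Unset Strict Implicit.
Unset Printing Implicit Defensive.

Import Order.TTheory GRing.Theory Num.Theory.
Import numFieldTopology.Exports numFieldNormedType.Exports.

Local Open Scope classical_set_scope.
Local Open Scope ring_scope.

(** * Densities and product measures *)

(** A score is a pointwise derivative, whereas membership in the two spaces is a statement about
    integrals, and differentiation under the integral sign cannot be justified for an arbitrary
    submodel. The two regularity clauses therefore do different work: the pointwise derivative gives
    the additive shape, and differentiability in mean square gives conditional mean 0, since it
    controls the mass of each event {X in A} to first order.

    Slicing is possible because, up to null sets, the support of P is a product: [p0] is nonzero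
    where [g0] and [eta0] are nonzero and the normalizer is finite. A property true P-a.e. thus
    holds on almost every slice.

    Integrability of h under the conditional law comes from Fubini applied to the element a itself,
    which on the slice at x differs from h by a constant.

    In the converse direction one estimate carries everything: |p_w - p0 (1 + w^T b)| <= K |w|^2 p0
    for all small w, off a single null set. Being simultaneous in w, it gives the pointwise score;
    being relative to [p0], it can be integrated and gives differentiability in mean square. *)

Lemma density_integral {d} {T : measurableType d} {R : realType}
    (m : {sigma_finite_measure set T -> \bar R}) (P : {finite_measure set T -> \bar R})
    (p f : T -> R) :
  measurable_fun setT p ->
  (forall A, measurable A -> P A = (\int[m]_(z in A) (p z)%:E)%E) ->
  measurable_fun setT f -> (forall t, 0 <= f t) ->
  (\int[P]_z (f z)%:E = \int[m]_z (f z * p z)%:E)%E.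
Proof.
move=> mp Pp mf f0.
have mEf : measurable_fun setT (EFin \o f) by exact/measurable_EFinP.
have mEp : measurable_fun setT (EFin \o p) by exact/measurable_EFinP.
have Pm : P `<< m.
  apply/null_content_dominatesP => A mA A0; rewrite Pp//.
  by apply: null_set_integral => //; exact: measurable_funTS.
have pi := Radon_Nikodym_SigmaFinite.f_integrable Pm.
(* [p] and the Radon-Nikodym derivative have the same integral over every measurable set. *)
have pE : ae_eq m setT (Radon_Nikodym_SigmaFinite.f P m) (EFin \o p).
  apply: integral_ae_eq => // E _ mE.
  by rewrite -Radon_Nikodym_SigmaFinite.f_integral//; exact: Pp.
rewrite -(Radon_Nikodym_SigmaFinite.change_of_variables Pm _ measurableT mEf)//.
apply: ae_eq_integral => //.
- by apply: emeasurable_funM => //; exact: measurable_int pi.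
- by apply/measurable_EFinP; exact: measurable_funM.
- by apply: filterS pE => z /[apply] ->; rewrite EFinM.
Qed.

(** A measurable set is P-null exactly when it meets {p != 0} in an m-null set. This moves
    statements about P to the product measure, where Fubini applies. *)
Lemma density_ae {d} {T : measurableType d} {R : realType}
    (m P : {measure set T -> \bar R}) (p : T -> R) (Q : T -> Prop) :
  measurable_fun setT p -> (forall t, 0 <= p t) ->
  (forall A, measurable A -> P A = (\int[m]_(z in A) (p z)%:E)%E) ->
  {ae P, forall z, Q z} <-> {ae m, forall z, p z != 0 -> Q z}.
Proof.
move=> mp p0 Pp.
have mEp : measurable_fun setT (EFin \o p) by exact/measurable_EFinP.
have p0E : [set z | p z != 0] = ~` (p @^-1` [set 0]).
  by apply/seteqP; split => z /= /eqP.
have mp0 : measurable (p @^-1` [set 0]).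
  by rewrite -[X in measurable X]setTI; exact: mp.
have mpn0 : measurable [set z | p z != 0] by rewrite p0E; exact: measurableC.
have PA A : measurable A -> P A = 0%E <-> m (A `&` [set z | p z != 0]) = 0%E.
  move=> mA; rewrite Pp//.
  have -> : (\int[m]_(z in A) (p z)%:E = \int[m]_(z in A) `|(p z)%:E|)%E.
    by apply: eq_integral => x _; rewrite gee0_abs ?lee_fin.
  have mA' : measurable (A `&` [set z | p z != 0]) by exact: measurableI.
  have mAp : measurable_fun A (EFin \o p) by exact: measurable_funS mEp.
  rewrite (ae_eq_integral_abs m mA mAp) -(negligibleP m mA').
  rewrite /ae_eq.
  suff -> : A `&` [set z | p z != 0] =
      ~` [set x | A x -> (EFin \o p) x = cst 0%E x] by [].
  apply/seteqP; split => z /=.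
    by move=> [Az pz] /(_ Az)[] /eqP; apply/negP.
  move/not_implyP => [Az] pz; split=> //; apply/eqP => pz0; apply: pz.
  by rewrite pz0.
split=> -[N [mN N0 QN]].
  exists (N `&` [set z | p z != 0]); split.
  - exact: measurableI.
  - exact/PA.
  - by move=> z /= /not_implyP[pz Qz]; split=> //; apply: QN.
exists (N `|` p @^-1` [set 0]); split.
- exact: measurableU.
- rewrite PA; last exact: measurableU.
  apply/eqP; rewrite -measure_le0 -N0; apply: le_measure; rewrite ?inE//.
    by apply: measurableI => //; exact: measurableU.
  by move=> z /= [[//|->]]; rewrite eqxx.
- move=> z /= nQ; have [->|pz] := eqVneq (p z) 0; [by right|left].
  by apply: QN => /= /(_ pz).
Qed.

(* Needed because the sigma-finite structure on [m1 \x m2] is not canonical: the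
   one for subprobabilities takes its place. *)
Lemma product_sigma_finite {d1 d2} {T1 : measurableType d1} {T2 : measurableType d2}
    {R : realType} (m1 : {sigma_finite_measure set T1 -> \bar R})
    (m2 : {sigma_finite_measure set T2 -> \bar R}) : sigma_finite setT (m1 \x m2)%E.
Proof.
have [[F FT Foo] [G GT Goo]] := (sigma_finiteT m1, sigma_finiteT m2).
exists (fun n => if unpickle n is Some ij then F ij.1 `*` G ij.2 else set0).
  apply/seteqP; split => // -[x y] _.
  have [[i _ Fx] [j _ Gy]] : (\bigcup_i F i) x /\ (\bigcup_j G j) y by rewrite -FT -GT.
  by exists (pickle (i, j)) => //=; rewrite pickleK.
move=> n; case: unpickle => [[i j]|]; last by rewrite measure0.
have [[mF Fi] [mG Gj]] := (Foo i, Goo j); split; first exact: measurableX.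
by rewrite product_measure1E// lte_mul_pinfty// ge0_fin_numE.
Qed.

Lemma product_density_integral {d1 d2} {T1 : measurableType d1} {T2 : measurableType d2}
    {R : realType} (m1 : {sigma_finite_measure set T1 -> \bar R})
    (m2 : {sigma_finite_measure set T2 -> \bar R}) (P : probability (T1 * T2)%type R)
    (p f : T1 * T2 -> R) :
  measurable_fun setT p ->
  (forall A, measurable A -> P A = (\int[(m1 \x m2)%E]_(z in A) (p z)%:E)%E) ->
  measurable_fun setT f -> (forall z, 0 <= f z) ->
  (\int[P]_z (f z)%:E = \int[(m1 \x m2)%E]_z (f z * p z)%:E)%E.
Proof.
move=> mp Pp.
pose m : {sigma_finite_measure set (T1 * T2)%type -> \bar R} :=
  HB.pack (m1 \x m2)%E (Measure_isSigmaFinite.Build _ _ _ (m1 \x m2)%E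
    (product_sigma_finite m1 m2)).
exact: (@density_integral _ _ _ m P p f mp Pp).
Qed.

Section product_ae.
Context {d1 d2} {T1 : measurableType d1} {T2 : measurableType d2} {R : realType}.
Variables (m1 : {sigma_finite_measure set T1 -> \bar R})
          (m2 : {sigma_finite_measure set T2 -> \bar R}).

(** By Tonelli the slice measures of a null set integrate to 0, so almost all of them are 0. *)
Lemma product_ae_ysection (Q : T1 * T2 -> Prop) :
  {ae (m1 \x m2)%E, forall z, Q z} ->
  {ae m2, forall x, {ae m1, forall y, Q (y, x)}}.
Proof.
move=> [N [mN N0 QN]].
have mi : measurable_fun setT (fun z => (\1_N z)%:E : \bar R).
  by apply/measurable_EFinP; exact: measurable_indic.
have i0 z : (0 <= (\1_N z)%:E :> \bar R)%E by rewrite lee_fin.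
have := fubini_tonelli2 (m1 := m1) (m2 := m2) _ mi i0.
rewrite integral_indic// setIT => /esym; rewrite [X in _ = X]N0.
under eq_integral => x _.
  rewrite -[fubini_G _ _ _]gee0_abs; last by apply: integral_ge0 => y _; exact: i0.
  over.
move/ae_eq_integral_abs => /(_ measurableT (measurable_fun_fubini_tonelli_G _ mi i0)).
apply: filterS => x /(_ I).
rewrite /fubini_G.
under eq_integral => y _.
  rewrite -[(_)%:E]gee0_abs; last exact: i0.
  over.
move/ae_eq_integral_abs => /(_ measurableT); rewrite /ae_eq => H.
have : measurable_fun setT (fun y => (\1_N (y, x))%:E : \bar R).
  exact: measurableT_comp mi _.
move/H; apply: filterS => y /(_ I) [] /eqP.
rewrite indicE; case: (boolP ((y,x) \in N)); first by rewrite oner_eq0.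
by rewrite notin_setE => yN _; apply: contrapT => nQ; apply: yN; apply: QN.
Qed.

Lemma product_ae_snd (Q : T2 -> Prop) :
  {ae m2, forall x, Q x} -> {ae (m1 \x m2)%E, forall z, Q z.2}.
Proof.
move=> [N [mN N0 QN]]; exists (setT `*` N); split.
- exact: measurableX.
- by rewrite product_measure1E// N0 mule0.
- by move=> z /= /QN.
Qed.

Lemma product_ae_xsection (Q : T1 * T2 -> Prop) :
  {ae (m1 \x m2)%E, forall z, Q z} ->
  {ae m1, forall y, {ae m2, forall x, Q (y, x)}}.
Proof.
move=> [N [mN N0 QN]].
have mi : measurable_fun setT (fun z => (\1_N z)%:E : \bar R).
  by apply/measurable_EFinP; exact: measurable_indic.
have i0 z : (0 <= (\1_N z)%:E :> \bar R)%E by rewrite lee_fin.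
have := fubini_tonelli1 (m1 := m1) (m2 := m2) _ mi i0.
rewrite integral_indic// setIT => /esym; rewrite [X in _ = X]N0.
under eq_integral => y _.
  rewrite -[fubini_F _ _ _]gee0_abs; last by apply: integral_ge0 => x _; exact: i0.
  over.
move/ae_eq_integral_abs => /(_ measurableT (measurable_fun_fubini_tonelli_F _ mi i0)).
apply: filterS => y /(_ I).
rewrite /fubini_F.
under eq_integral => x _.
  rewrite -[(_)%:E]gee0_abs; last exact: i0.
  over.
move/ae_eq_integral_abs => /(_ measurableT); rewrite /ae_eq => H.
have : measurable_fun setT (fun x => (\1_N (y, x))%:E : \bar R).
  exact: measurableT_comp mi _.
move/H; apply: filterS => x /(_ I) [] /eqP.
rewrite indicE; case: (boolP ((y,x) \in N)); first by rewrite oner_eq0.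
by rewrite notin_setE => yN _; apply: contrapT => nQ; apply: yN; apply: QN.
Qed.

Lemma product_ae_fst (Q : T1 -> Prop) :
  {ae m1, forall x, Q x} -> {ae (m1 \x m2)%E, forall z, Q z.1}.
Proof.
move=> [N [mN N0 QN]]; exists (N `*` setT); split.
- exact: measurableX.
- by rewrite product_measure1E// [X in (X * _)%E]N0 mul0e.
- by move=> z /= /QN.
Qed.

End product_ae.

(** * Conditional and joint densities of the model *)

Section conditional_density.
Context {R : realType} {q : nat}.
Variables (nu : {sigma_finite_measure set (measurableTypeR R) -> \bar R})
          (mu : {sigma_finite_measure set (covariate R q) -> \bar R}).
Implicit Types (beta : 'cV[R]_q) (g : R -> R) (eta : covariate R q -> R).

Lemma measurable_funV_ge0 {d} {T : measurableType d} (f : T -> R) :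
  measurable_fun setT f -> (forall t, 0 <= f t) ->
  measurable_fun setT (fun t => (f t)^-1).
Proof.
move=> mf f0.
under eq_fun do rewrite -powR_inv1//.
exact: (measurableT_comp (measurable_powR (-1)) mf).
Qed.

Lemma measurable_dot beta : measurable_fun setT (dot beta).
Proof.
apply: measurable_sum => i; apply: measurable_funM => //.
exact: measurable_tnth.
Qed.

Lemma measurable_exp_tilt beta g :
  measurable_fun [set: measurableTypeR R] g ->
  measurable_fun setT (fun z : observation R q => expR (dot beta z.2 * z.1) * g z.1).
Proof.
move=> mg; apply: measurable_funM; last exact: measurableT_comp.
apply: measurableT_comp => //; apply: measurable_funM; last exact: measurable_fst.
exact: measurableT_comp (measurable_dot _) _.
Qed.

Lemma measurable_normalizer beta g :
  measurable_fun [set: measurableTypeR R] g -> (forall y, 0 <= g y) ->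
  measurable_fun setT (normalizer nu beta g).
Proof.
move=> mg g0.
apply: (measurable_fun_fubini_tonelli_G (m1 := nu)
  (fun z : observation R q => (expR (dot beta z.2 * z.1) * g z.1)%:E)).
  by apply/measurable_EFinP; exact: measurable_exp_tilt.
by move=> z; rewrite lee_fin mulr_ge0 ?expR_ge0.
Qed.

Lemma measurable_cond_density beta g :
  measurable_fun [set: measurableTypeR R] g -> (forall y, 0 <= g y) ->
  measurable_fun setT (fun z : observation R q => cond_density nu beta g z.1 z.2).
Proof.
move=> mg g0; apply: measurable_funM; first exact: measurable_exp_tilt.
apply: measurable_funV_ge0 => [|z].
  apply: measurableT_comp => //; apply: measurableT_comp => //.
  exact: measurable_normalizer.
by rewrite fine_ge0//; apply: integral_ge0 => y _; rewrite lee_fin mulr_ge0 ?expR_ge0.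
Qed.

Lemma measurable_cond_density_y beta g x :
  measurable_fun [set: measurableTypeR R] g ->
  measurable_fun [set: measurableTypeR R] (fun y => cond_density nu beta g y x).
Proof.
move=> mg; apply: measurable_funM => //; apply: measurable_funM => //.
by apply: measurableT_comp => //; exact: measurable_funM.
Qed.

Lemma cond_density_ge0 beta g y x :
  (forall y, 0 <= g y) -> 0 <= cond_density nu beta g y x.
Proof.
move=> g0; rewrite /cond_density mulr_ge0// ?mulr_ge0 ?expR_ge0//.
rewrite invr_ge0 fine_ge0//; apply: integral_ge0 => t _.
by rewrite lee_fin mulr_ge0 ?expR_ge0.
Qed.

(** The exponential factor is positive, so a zero normalizer would make [g] vanish a.e., against its
    total mass 1. *)
Lemma normalizer_gt0 beta g x : is_density nu g -> (0 < normalizer nu beta g x)%E.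
Proof.
move=> [mg g0 g1].
have mE : measurable_fun setT (fun y : measurableTypeR R => (expR (dot beta x * y) * g y)%:E).
  apply/measurable_EFinP; apply: measurable_funM => //.
  by apply: measurableT_comp => //; exact: measurable_funM.
have E0 y : (0 <= (expR (dot beta x * y) * g y)%:E)%E.
  by rewrite lee_fin mulr_ge0 ?expR_ge0.
rewrite lt0e integral_ge0// andbT; apply/negP => /eqP N0.
have : (\int[nu]_y `|(expR (dot beta x * y) * g y)%:E| = 0)%E.
  by rewrite -[RHS]N0; apply: eq_integral => y _; rewrite gee0_abs.
move/(ae_eq_integral_abs nu measurableT mE) => ae0.
have : (\int[nu]_t (g t)%:E = \int[nu]_t cst 0 t)%E.
  apply: ae_eq_integral => //; first exact/measurable_EFinP.
  apply: filterS ae0 => y /(_ I) [] /eqP + _; rewrite mulf_eq0 gt_eqF ?expR_gt0//=.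
  by move=> /eqP ->.
by rewrite [LHS]g1 integral0 => /eqP; rewrite onee_eq0.
Qed.

Lemma cond_density_integral1 beta g x : is_density nu g ->
  (normalizer nu beta g x < +oo)%E ->
  (\int[nu]_y (cond_density nu beta g y x)%:E = 1)%E.
Proof.
move=> dg fN; have [mg g0 g1] := dg; have N0 := normalizer_gt0 beta x dg.
rewrite /cond_density; under eq_integral do rewrite EFinM.
rewrite ge0_integralZr//; last 3 first.
- apply/measurable_EFinP; apply: measurable_funM => //.
  by apply: measurableT_comp => //; exact: measurable_funM.
- by move=> y _; rewrite lee_fin mulr_ge0 ?expR_ge0.
- by rewrite lee_fin invr_ge0 fine_ge0 ?ltW.
rewrite -/(normalizer nu beta g x) -[X in (X * _)%E]fineK; last first.
  by rewrite ge0_fin_numE ?ltW.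
by rewrite -EFinM divff// gt_eqF// fine_gt0// N0.
Qed.

Lemma cond_density_gt0 beta g y x : is_density nu g ->
  (normalizer nu beta g x < +oo)%E -> g y != 0 -> 0 < cond_density nu beta g y x.
Proof.
move=> dg fN gy; have [mg g0 g1] := dg; have N0 := normalizer_gt0 beta x dg.
rewrite /cond_density divr_gt0 ?mulr_gt0 ?expR_gt0 ?lt0r ?gy ?g0//.
by rewrite -lt0r fine_gt0 ?N0.
Qed.

Lemma measurable_joint_density beta g eta :
  measurable_fun [set: measurableTypeR R] g -> (forall y, 0 <= g y) ->
  measurable_fun setT eta ->
  measurable_fun setT (joint_density nu beta g eta).
Proof.
move=> mg g0 me; apply: measurable_funM; first exact: measurable_cond_density.
exact: measurableT_comp.
Qed.

Lemma joint_density_ge0 beta g eta z :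
  (forall y, 0 <= g y) -> (forall x, 0 <= eta x) ->
  0 <= joint_density nu beta g eta z.
Proof. by move=> g0 e0; rewrite mulr_ge0 ?cond_density_ge0. Qed.

(** The law of X has density [eta], whatever [beta] and [g]: this is what makes the mass of {X in A}
    constant along a submodel for g. *)
Lemma joint_density_marginal beta g eta (f : covariate R q -> R) :
  in_model nu mu beta g eta ->
  measurable_fun setT f -> (forall x, 0 <= f x) ->
  (\int[nu \x mu]_z (f z.2 * joint_density nu beta g eta z)%:E =
   \int[mu]_x (f x * eta x)%:E)%E.
Proof.
move=> [dg [me e0 e1] fN] mf f0; have [mg g0 g1] := dg.
have mj := measurable_joint_density beta mg g0 me.
rewrite fubini_tonelli2; last 2 first.
- apply/measurable_EFinP; apply: measurable_funM => //.
  exact: measurableT_comp mf _.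
- by move=> z; rewrite lee_fin mulr_ge0// joint_density_ge0.
apply: ge0_ae_eq_integral => //.
- apply: measurable_fun_fubini_tonelli_G.
    apply/measurable_EFinP; apply: measurable_funM => //.
    exact: measurableT_comp mf _.
  by move=> z; rewrite lee_fin mulr_ge0// joint_density_ge0.
- by apply/measurable_EFinP; exact: measurable_funM.
- move=> x _; apply: integral_ge0 => y _.
  by rewrite lee_fin mulr_ge0// joint_density_ge0.
- by move=> x _; rewrite lee_fin mulr_ge0.
apply: filterS fN => x fN _.
(* Where [eta] vanishes the normalizer may be infinite, but both sides are then 0. *)
have [ex0|ex] := eqVneq (eta x) 0.
  rewrite ex0 mulr0 [LHS]integral0_eq// => y _.
  by rewrite /joint_density/= ex0 mulr0 mulr0.
rewrite /fubini_G/=.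
have := cond_density_integral1 dg (fN ex) => k1.
under eq_integral => y _ do rewrite /joint_density/= mulrCA mulrC EFinM.
rewrite ge0_integralZl//.
- by rewrite k1 mule1.
- by apply/measurable_EFinP; exact: measurable_cond_density_y.
- by move=> y _; rewrite lee_fin cond_density_ge0.
- by rewrite lee_fin mulr_ge0.
Qed.

End conditional_density.

(** * Almost everywhere convergence and choice of base points *)

Section ae_limits.
Context {d} {T : measurableType d} {R : realType}.
Variable (m : {measure set T -> \bar R}).

(** A Borel-Cantelli argument: the series of the [e n] has integral at most 1, so it converges a.e.
    and its terms, bounded by its tails, tend to 0. *)
Lemma ae_cvg0_of_summable_integrals (e : nat -> T -> R) :
  (forall n, measurable_fun setT (e n)) -> (forall n t, 0 <= e n t) ->
  (forall n, (\int[m]_t (e n t)%:E <= (1 / (2 ^ n.+1)%:R)%:E)%E) ->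
  {ae m, forall t, e ^~ t @ \oo --> 0}.
Proof.
move=> me e0 le.
have mE n : measurable_fun setT (fun t => (e n t)%:E) by exact/measurable_EFinP.
have Sint : (\int[m]_t (\sum_(n <oo) (e n t)%:E) < +oo)%E.
  rewrite integral_nneseries//; last by move=> n t _; rewrite lee_fin.
  apply: (@le_lt_trans _ _ 1%E); last by rewrite ltry.
  have /(le_trans _) := @epsilon_trick0 R 1 xpredT ler01; apply.
  by apply: lee_nneseries => // n _ _; apply: integral_ge0 => t _; rewrite lee_fin.
have mS : measurable_fun setT (fun t => \sum_(n <oo) (e n t)%:E)%E.
  by apply: ge0_emeasurable_sum => // n t _ _; rewrite lee_fin.
have S0 t : (0 <= \sum_(n <oo) (e n t)%:E)%E.
  by apply: nneseries_ge0 => n _ _; rewrite lee_fin.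
have : m.-integrable setT (fun t => \sum_(n <oo) (e n t)%:E)%E.
  apply/integrableP; split => //.
  by under eq_integral do rewrite gee0_abs//.
move/integrable_ae => /(_ measurableT); apply: filterS => t /(_ I) fint.
have Slt : (\sum_(0 <= n <oo) (e n t)%:E < +oo)%E by rewrite -ge0_fin_numE.
have tail := nneseries_tail_cvg Slt (fun n _ => e0 n t).
suff : (fun n => (e n t)%:E) @ \oo --> 0%:E by exact: fine_cvg.
apply: (squeeze_cvge _ (@cvg_cst _ (0%:E : \bar R) _ _ _) tail).
apply: nearW => n /=; rewrite lee_fin e0/=.
have := @nneseries_lim_ge R (fun n => (e n t)%:E) xpredT n n.+1.
by rewrite big_nat1; apply => k _ _; rewrite lee_fin.
Qed.

(** Supplies the base points at which slices are taken: a density of mass 1 cannot vanish a.e. *)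
Lemma density_neq0_ex (g : T -> R) (Q : T -> Prop) :
  is_density m g -> {ae m, forall y, g y != 0 -> Q y} ->
  exists2 y, g y != 0 & Q y.
Proof.
move=> [mg g0 g1] aeQ; apply: contrapT => nQ.
have : (\int[m]_t (g t)%:E = \int[m]_t cst 0 t)%E.
  apply: ae_eq_integral => //; first exact/measurable_EFinP.
  apply: filterS aeQ => y gQ _; apply/eqP; rewrite eqe; apply: contrapT => gy.
  by apply: nQ; exists y; [exact/negP|apply: gQ; exact/negP].
by rewrite [LHS]g1 integral0 => /eqP; rewrite onee_eq0.
Qed.

End ae_limits.

Lemma ae_forall_ord {d} {T : measurableType d} {R : realType}
    (m : {measure set T -> \bar R}) (n : nat) (Q : 'I_n -> T -> Prop) :
  (forall i, {ae m, forall t, Q i t}) -> {ae m, forall t, forall i, Q i t}.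
Proof.
move=> aeQ.
have : {ae m, forall t, forall k : nat, forall i : 'I_n, i = k :> nat -> Q i t}.
  apply: ae_foralln => k; have [kn|nk] := ltnP k n.
    apply: filterS (aeQ (Ordinal kn)) => t Qt i ik.
    by rewrite (_ : i = Ordinal kn)//; exact/val_inj.
  by apply: aeW => t i ik; move: nk; rewrite -ik leqNgt ltn_ord.
by apply: filterS => t Qt i; exact: (Qt i i).
Qed.

(** * Scores of paths differentiable in mean square *)

Section differentiability_in_quadratic_mean.
Context {d} {T : measurableType d} {R : realType}.
Variables (m : {measure set T -> \bar R}).

Lemma integrable_of_bound (f g : T -> R) :
  measurable_fun setT f -> measurable_fun setT g ->
  (forall t, `|f t| <= g t) -> (\int[m]_t (g t)%:E < +oo)%E ->
  m.-integrable setT (EFin \o f).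
Proof.
move=> mf mg fg gfin; apply/integrableP; split; first exact/measurable_EFinP.
apply: le_lt_trans gfin; apply: ge0_le_integral => //.
- by apply: measurableT_comp => //; exact/measurable_EFinP.
- exact/measurable_EFinP.
- by move=> t _ /=; rewrite lee_fin.
Qed.

Lemma ge0_integral_lin3 (a b c : R) (f g h : T -> R) :
  0 <= a -> 0 <= b -> 0 <= c ->
  measurable_fun setT f -> measurable_fun setT g -> measurable_fun setT h ->
  (forall t, 0 <= f t) -> (forall t, 0 <= g t) -> (forall t, 0 <= h t) ->
  (\int[m]_t (a * f t + (b * g t + c * h t))%:E =
   a%:E * \int[m]_t (f t)%:E +
   (b%:E * \int[m]_t (g t)%:E + c%:E * \int[m]_t (h t)%:E))%E.
Proof.
move=> a0 b0 c0 mf mg mh f0 g0 h0.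
have lin k (u : T -> R) : 0 <= k -> measurable_fun setT u -> (forall t, 0 <= u t) ->
    (\int[m]_t (k * u t)%:E = k%:E * \int[m]_t (u t)%:E)%E.
  move=> k0 mu u0; under eq_integral do rewrite EFinM.
  by rewrite ge0_integralZl//; [exact/measurable_EFinP|move=> t _; rewrite lee_fin].
have add (u v : T -> R) : measurable_fun setT u -> measurable_fun setT v ->
    (forall t, 0 <= u t) -> (forall t, 0 <= v t) ->
    (\int[m]_t (u t + v t)%:E = \int[m]_t (u t)%:E + \int[m]_t (v t)%:E)%E.
  move=> mu mv u0 v0; under eq_integral do rewrite EFinD.
  by rewrite ge0_integralD//; first [exact/measurable_EFinP|move=> t _; rewrite lee_fin].
have mZ k (u : T -> R) : measurable_fun setT u -> measurable_fun setT (fun t => k * u t).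
  by move=> mu; exact: measurable_funM.
rewrite add ?lin//; first by rewrite add ?lin//; try exact: mZ; move=> t; rewrite mulr_ge0.
- exact: mZ.
- by apply: measurable_funD; exact: mZ.
- by move=> t; rewrite mulr_ge0.
- by move=> t; rewrite addr_ge0 ?mulr_ge0.
Qed.

(* u and v stand for the square roots of the densities at t and at 0. *)
Lemma dqm_remainder_bound (u v s t c : R) : 0 <= u -> 0 <= v -> 0 < t -> 0 < c ->
  `|t * (s * v ^+ 2) - (u ^+ 2 - v ^+ 2)| <=
  (2 + (c * t)^-1) * (u - v - 2^-1 * (t * s) * v) ^+ 2 +
  ((t ^+ 2 / 2) * (s ^+ 2 * v ^+ 2) + (c * t) * v ^+ 2).
Proof.
move=> u0 v0 t0 c0; set r := u - v - _.
have ct : 0 < c * t by exact: mulr_gt0.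
have -> : t * (s * v ^+ 2) - (u ^+ 2 - v ^+ 2) = - (u - v) ^+ 2 - 2 * (v * r).
  by rewrite /r; field.
have H1 : (u - v) ^+ 2 <= 2 * r ^+ 2 + (t ^+ 2 / 2) * (s ^+ 2 * v ^+ 2).
  have -> : u - v = r + 2^-1 * (t * s) * v by rewrite /r; ring.
  by have := sqr_ge0 (r - 2^-1 * (t * s) * v); nra.
(* AM-GM: 2 |v r| <= k v^2 + r^2 / k with k = c t *)
have H2 : `|2 * (v * r)| <= (c * t) * v ^+ 2 + (c * t)^-1 * r ^+ 2.
  set k := c * t in ct *.
  have e1 : k * v ^+ 2 + k^-1 * r ^+ 2 - 2 * (v * r) = k^-1 * (k * v - r) ^+ 2.
    by field; exact: lt0r_neq0.
  have e2 : k * v ^+ 2 + k^-1 * r ^+ 2 + 2 * (v * r) = k^-1 * (k * v + r) ^+ 2.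
    by field; exact: lt0r_neq0.
  have p1 : 0 <= k^-1 * (k * v - r) ^+ 2 by rewrite mulr_ge0 ?sqr_ge0 ?invr_ge0 ?ltW.
  have p2 : 0 <= k^-1 * (k * v + r) ^+ 2 by rewrite mulr_ge0 ?sqr_ge0 ?invr_ge0 ?ltW.
  by rewrite ler_norml; lra.
have := ler_normD (- (u - v) ^+ 2) (- (2 * (v * r))).
by rewrite !normrN [`|(u - v) ^+ 2|]ger0_norm ?sqr_ge0//; lra.
Qed.

(* The mass of A does not depend on t, so t times the integral of the score over
   A is bounded by the remainder of the expansion, which is o(t). *)
Lemma dqm_score_mean0 (p : R -> T -> R) (s : T -> R) (A : set T) :
  (forall t, measurable_fun setT (p t)) -> (forall t z, 0 <= p t z) ->
  measurable_fun setT s -> measurable A ->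
  (\int[m]_z (p 0%R z)%:E = 1)%E ->
  (\int[m]_z (s z ^+ 2 * p 0%R z)%:E < +oo)%E ->
  (forall t, \int[m]_(z in A) (p t z)%:E = \int[m]_(z in A) (p 0%R z)%:E)%E ->
  (forall e, 0 < e -> \forall t \near 0,
     (\int[m]_z ((Num.sqrt (p t z) - Num.sqrt (p 0 z)
        - 2^-1 * (t * s z) * Num.sqrt (p 0 z)) ^+ 2)%:E <= (e * t ^+ 2)%:E)%E) ->
  (\int[m]_(z in A) (s z * p 0%R z)%:E = 0)%E.
Proof.
move=> mp p_ge0 ms mA p01 sfin pA dqm.
have mEp t : measurable_fun setT (EFin \o p t) by exact/measurable_EFinP.
have ms2p : measurable_fun setT (fun z => s z ^+ 2 * p 0 z).
  by apply: measurable_funM => //; exact: measurable_funX.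
have s2p0 z : 0 <= s z ^+ 2 * p 0 z by rewrite mulr_ge0 ?sqr_ge0.
have ip0 : m.-integrable setT (EFin \o p 0).
  by apply: (@integrable_of_bound _ (p 0)) => //= [z|]; rewrite ?ger0_norm// p01 ltry.
have isp : m.-integrable setT (EFin \o (fun z => s z * p 0 z)).
  apply: (@integrable_of_bound _ (fun z => p 0 z + s z ^+ 2 * p 0 z)).
  - exact: measurable_funM.
  - exact: measurable_funD.
  - move=> z; rewrite normrM [`|p 0 z|]ger0_norm// -[X in X + _]mul1r -mulrDl.
    apply: ler_wpM2r => //; rewrite -real_normK ?num_real//.
    by have := sqr_ge0 (`|s z| - 1); have := normr_ge0 (s z); nra.
  - under eq_integral do rewrite EFinD.
    rewrite ge0_integralD//; last 4 first.
    + by move=> z _; rewrite lee_fin.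
    + exact: mEp.
    + by move=> z _; rewrite lee_fin.
    + exact/measurable_EFinP.
    by rewrite p01 lte_add_pinfty// ltry.
have fin_setA (f : T -> R) : m.-integrable setT (EFin \o f) ->
    m.-integrable A (EFin \o f).
  by move=> fi; apply: integrableS fi.
have ipA t : m.-integrable A (EFin \o p t).
  apply/integrableP; split; first exact: measurable_funTS.
  under eq_integral do rewrite /= ger0_norm//.
  rewrite pA; have /fin_setA/integrableP[_] := ip0.
  by under eq_integral do rewrite /= ger0_norm//.
have [I0 Ifin] : (0 <= \int[m]_z (s z ^+ 2 * p 0 z)%:E)%E /\
    (\int[m]_z (s z ^+ 2 * p 0 z)%:E)%E \is a fin_num.
  have I0 : (0 <= \int[m]_z (s z ^+ 2 * p 0 z)%:E)%E.
    by apply: integral_ge0 => z _; rewrite lee_fin.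
  by split=> //; rewrite ge0_fin_numE.
set I := fine (\int[m]_z (s z ^+ 2 * p 0 z)%:E)%E.
have IE : (\int[m]_z (s z ^+ 2 * p 0 z)%:E)%E = I%:E by rewrite /I fineK.
have I_ge0 : 0 <= I by rewrite fine_ge0.
have Jfin := integrable_fin_num mA (fin_setA _ isp).
set J := fine (\int[m]_(z in A) (s z * p 0 z)%:E)%E.
have JE : (\int[m]_(z in A) (s z * p 0 z)%:E)%E = J%:E by rewrite /J fineK.
rewrite JE; congr EFin; apply/eqP; rewrite -normr_le0; apply/ler_addgt0Pl => e e0.
rewrite addr0.
(* After division by t the final bound is 2 c (c t) + 2 c + t I / 2, at most 5 c because c, t <= 1
   and t I <= c. Mean-square differentiability is used at accuracy c ^ 2 so that the factor (c t)^-1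
   leaves a term c t. *)
pose c := Num.min 1 (e / 5).
have c0 : 0 < c by rewrite lt_min ltr01 divr_gt0.
have c1 : c <= 1 by rewrite ge_min lexx.
have c5 : c * 5 <= e by rewrite -ler_pdivlMr// ge_min lexx orbT.
have [t t0 [t1 tI tdqm]] : exists2 t, 0 < t & [/\ t <= 1, t * I <= c &
    (\int[m]_z ((Num.sqrt (p t z) - Num.sqrt (p 0 z)
        - 2^-1 * (t * s z) * Num.sqrt (p 0 z)) ^+ 2)%:E <= (c ^+ 2 * t ^+ 2)%:E)%E].
  have /nbhs_ballP[/= k k0 kb] := dqm _ (exprn_gt0 2 c0).
  pose t := Num.min (k / 2) (Num.min 1 (c / (1 + I))).
  have I1 : 0 < 1 + I by rewrite ltr_pwDl.
  have t0 : 0 < t by rewrite !lt_min ltr01 !divr_gt0.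
  exists t => //; split.
  - by rewrite !ge_min lexx orbT.
  - have : t <= c / (1 + I) by rewrite !ge_min lexx !orbT.
    by rewrite ler_pdivlMr// mulrDr mulr1; lra.
  - apply: kb; rewrite /ball/= sub0r normrN gtr0_norm//.
    by rewrite gt_min ltr_pdivrMr// mulr2n mulrDr mulr1 ltrDl k0.
pose r z := Num.sqrt (p t z) - Num.sqrt (p 0 z)
        - 2^-1 * (t * s z) * Num.sqrt (p 0 z).
have mr : measurable_fun setT (fun z => r z ^+ 2).
  have msq u : measurable_fun setT (fun z => Num.sqrt (p u z)).
    exact: measurableT_comp (continuous_measurable_fun (@sqrt_continuous R)) _.
  apply: measurable_funX; apply: measurable_funB; first exact: measurable_funB.
  by apply: measurable_funM => //; do 2 apply: measurable_funM => //.
pose F z := t * (s z * p 0 z) - (p t z - p 0 z).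
have ct0 : 0 < c * t by exact: mulr_gt0.
have Fle z : `|F z| <= (2 + (c * t)^-1) * r z ^+ 2 +
    ((t ^+ 2 / 2) * (s z ^+ 2 * p 0 z) + (c * t) * p 0 z).
  have := @dqm_remainder_bound (Num.sqrt (p t z)) (Num.sqrt (p 0 z)) (s z) t c
    (sqrtr_ge0 _) (sqrtr_ge0 _) t0 c0.
  by rewrite !sqr_sqrtr.
have Fint : (\int[m]_(z in A) (F z)%:E = (t * J)%:E)%E.
  rewrite /F; under eq_integral do rewrite EFinB.
  rewrite integralB//; last 2 first.
  - by under eq_fun do rewrite EFinM; apply: integrableZl => //; exact: fin_setA.
  - exact: (integrableB mA (ipA t) (ipA 0)).
  under eq_integral do rewrite EFinM.
  rewrite integralZl//; last exact: fin_setA.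
  rewrite JE; under [X in (_ - X)%E]eq_integral do rewrite EFinB.
  rewrite (integralB mA (ipA t) (ipA 0))/= pA subee ?sube0//.
  exact: (integrable_fin_num mA (ipA 0)).
have mF : measurable_fun setT F.
  by apply: measurable_funB; [do 2 apply: measurable_funM => //|exact: measurable_funB].
have : (`|t * J|%:E <= ((2 + (c * t)^-1) * (c ^+ 2 * t ^+ 2) +
    ((t ^+ 2 / 2) * I + (c * t)))%:E)%E.
  rewrite -abse_EFin -Fint.
  apply: (le_trans (le_abse_integral _ _ _)) => //.
    exact/measurable_EFinP/measurable_funTS.
  apply: (@le_trans _ _ (\int[m]_z ((2 + (c * t)^-1) * r z ^+ 2 +
    ((t ^+ 2 / 2) * (s z ^+ 2 * p 0 z) + (c * t) * p 0 z))%:E)%E).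
    apply: (@le_trans _ _ (\int[m]_z `|(F z)%:E|)%E).
      apply: ge0_subset_integral => //; apply: measurableT_comp => //.
      exact/measurable_EFinP.
    apply: ge0_le_integral => //.
    - by apply: measurableT_comp => //; exact/measurable_EFinP.
    - apply/measurable_EFinP; apply: measurable_funD; first exact: measurable_funM.
      by apply: measurable_funD; exact: measurable_funM.
    - by move=> z _; rewrite abse_EFin lee_fin; exact: Fle.
  have k1 : 0 <= 2 + (c * t)^-1 by rewrite addr_ge0// invr_ge0 ltW.
  have k2 : 0 <= t ^+ 2 / 2 by rewrite divr_ge0 ?sqr_ge0.
  rewrite (ge0_integral_lin3 (f := fun z => r z ^+ 2)
    (g := fun z => s z ^+ 2 * p 0 z) (h := p 0))//; last 2 first.
  - exact: ltW.
  - by move=> z; rewrite sqr_ge0.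
  rewrite p01 mule1 IE !EFinD leeD2r// EFinM lee_wpmul2l ?lee_fin//.
rewrite lee_fin normrM gtr0_norm// => Jle; rewrite -(ler_pM2l t0).
apply: (le_trans Jle).
apply: (@le_trans _ _ (t * (c * 5))); last by rewrite ler_pM2l.
have -> : (2 + (c * t)^-1) * (c ^+ 2 * t ^+ 2) = 2 * c ^+ 2 * t ^+ 2 + c * t.
  by field; rewrite !gt_eqF.
have -> : 2 * c ^+ 2 * t ^+ 2 + c * t + (t ^+ 2 / 2 * I + c * t) =
   t * (2 * (c * (c * t)) + c + t * I / 2 + c) by field.
rewrite ler_pM2l//.
have : c * (c * t) <= c by nra.
by lra.
Qed.

End differentiability_in_quadratic_mean.

(** * Square-integrable vector functions *)

Lemma measurable_vecB {d} {T : measurableType d} {R : realType} {k : nat}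
    (a b : T -> 'cV[R]_k) :
  measurable_vec a -> measurable_vec b -> measurable_vec (fun z => a z - b z).
Proof.
move=> ma mb i; under eq_fun do rewrite !mxE.
by apply: measurable_funB; [exact: ma|exact: mb].
Qed.

Lemma measurable_vec_mulmx {d} {T : measurableType d} {R : realType} {k r : nat}
    (A : 'M[R]_(r, k)) (b : T -> 'cV[R]_k) :
  measurable_vec b -> measurable_vec (fun z => A *m b z).
Proof.
move=> mb i; under eq_fun do rewrite mxE.
by apply: measurable_sum => j; apply: measurable_funM => //; exact: mb.
Qed.

Section second_moments.
Context {d} {T : measurableType d} {R : realType} {k : nat}.
Variable P : probability T R.

(** The squared L2 norm over any probability space; for observations it is [inner P w w]. It is
    extended-real valued, so that finiteness can be stated. *)
Definition l2norm2 (w : T -> 'cV[R]_k) : \bar R :=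
  (\int[P]_z (\sum_i (w z i 0) ^+ 2)%:E)%E.

Lemma measurable_sumsq (w : T -> 'cV[R]_k) :
  measurable_vec w -> measurable_fun setT (fun z => \sum_i (w z i 0) ^+ 2).
Proof.
by move=> mw; apply: measurable_sum => i; apply: measurable_funX; exact: mw.
Qed.

Let sumsq_ge (w : T -> 'cV[R]_k) z i : (w z i 0) ^+ 2 <= \sum_j (w z j 0) ^+ 2.
Proof.
by rewrite (bigD1 i)//= lerDl; apply: sumr_ge0 => j _; exact: sqr_ge0.
Qed.

Let sumsq_ge0 (w : T -> 'cV[R]_k) z : 0 <= \sum_j (w z j 0) ^+ 2.
Proof. by apply: sumr_ge0 => j _; exact: sqr_ge0. Qed.

Let P1 : (\int[P]_z (cst (1 : R) z)%:E = 1)%E.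
Proof.
transitivity (\int[P]_z cst 1 z)%E; first exact: eq_integral.
rewrite integral_cst// mul1e; exact: probability_setT.
Qed.

Lemma l2_integrable (w : T -> 'cV[R]_k) i : measurable_vec w ->
  (l2norm2 w < +oo)%E -> P.-integrable setT (fun z => (w z i 0)%:E).
Proof.
move=> mw wfin.
apply: (@integrable_of_bound _ _ _ P (fun z => w z i 0)
   (fun z => cst 1 z + \sum_j (w z j 0) ^+ 2)).
- exact: mw.
- by apply: measurable_funD => //; exact: measurable_sumsq.
- move=> z /=; apply: (@le_trans _ _ (1 + (w z i 0) ^+ 2)); last by rewrite lerD2l.
  rewrite -real_normK ?num_real//.
  by have := sqr_ge0 (`|w z i 0| - 1); have := normr_ge0 (w z i 0); nra.
- under eq_integral do rewrite EFinD.
  rewrite ge0_integralD//; last 3 first.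
  + exact/measurable_EFinP.
  + by move=> z _; rewrite lee_fin.
  + by apply/measurable_EFinP; exact: measurable_sumsq.
  rewrite P1.
  by apply: lte_add_pinfty; rewrite ?ltry.
Qed.

(** Stands in for Cauchy-Schwarz when integrals over a set are passed to mean-square limits: with
    weight [e], each half of the AM-GM bound contributes e / 2. *)
Lemma l2_integral_bound (w : T -> 'cV[R]_k) i (B : set T) (e : R) :
  measurable_vec w -> measurable B -> 0 < e -> (l2norm2 w < (e ^+ 2)%:E)%E ->
  (`|\int[P]_(z in B) (w z i 0)%:E| <= e%:E)%E.
Proof.
move=> mw mB e0 we.
have e2 : 0 <= (2 * e)^-1 by rewrite invr_ge0 mulr_ge0// ltW.
have mi : measurable_fun setT (fun z => (w z i 0)%:E) by apply/measurable_EFinP; exact: mw.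
apply: (le_trans (le_abse_integral _ _ _)) => //; first exact: measurable_funTS.
apply: (@le_trans _ _ (\int[P]_z `|(w z i 0)%:E|)%E).
  by apply: ge0_subset_integral => //; exact: measurableT_comp.
(* AM-GM: |w_i| <= w_i^2 / (2 e) + e / 2 *)
apply: (@le_trans _ _ (\int[P]_z ((2 * e)^-1 * (\sum_j (w z j 0) ^+ 2) + (0 * cst 0 z + (e / 2) * cst 1 z))%:E)%E).
  apply: ge0_le_integral => //.
  - exact: measurableT_comp.
  - apply/measurable_EFinP; apply: measurable_funD.
      by apply: measurable_funM => //; exact: measurable_sumsq.
    by apply: measurable_funD => //; exact: measurable_funM.
  - move=> z _; rewrite /= mulr1 mulr0 add0r lee_fin.
    apply: (@le_trans _ _ ((2 * e)^-1 * (w z i 0) ^+ 2 + e / 2)); last first.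
      by rewrite lerD2r ler_wpM2l//; exact: sumsq_ge.
    have -> : (2 * e)^-1 * w z i 0 ^+ 2 + e / 2 =
       `|w z i 0| + (2 * e)^-1 * (`|w z i 0| - e) ^+ 2.
      rewrite -[w z i 0 ^+ 2]real_normK ?num_real//; field; exact: lt0r_neq0.
    by rewrite lerDl mulr_ge0 ?sqr_ge0.
rewrite (@ge0_integral_lin3 _ _ _ P _ _ _ (fun z => \sum_j (w z j 0) ^+ 2) (cst 0) (cst 1))//; last 2 first.
- by rewrite divr_ge0// ltW.
- exact: measurable_sumsq.
rewrite mul0e add0e P1 mule1.
apply: (@le_trans _ _ (((2 * e)^-1 * e ^+ 2 + e / 2)%:E)).
  by rewrite EFinD leeD2r// EFinM lee_wpmul2l ?lee_fin// ltW.
by rewrite lee_fin le_eqVlt; apply/orP; left; apply/eqP; field; exact: lt0r_neq0.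
Qed.

(** The geometric rate makes the squared norms summable, so mean-square convergence becomes a.e.
    convergence without extracting a subsequence. *)
Lemma l2_cvg_ae (w : nat -> T -> 'cV[R]_k) : (forall n, measurable_vec (w n)) ->
  (forall n, (l2norm2 (w n) < (1 / (2 ^ n.+1)%:R)%:E)%E) ->
  {ae P, forall z, forall i, w n z i 0 @[n --> \oo] --> 0}.
Proof.
move=> mw wn.
have := @ae_cvg0_of_summable_integrals _ _ _ P (fun n z => \sum_j (w n z j 0) ^+ 2)
  (fun n => measurable_sumsq (mw n)) (fun n z => sumsq_ge0 _ _)
  (fun n => ltW (wn n)).
apply: filterS => z cz i; apply/norm_cvg0P.
have : Num.sqrt (\sum_j w n z j 0 ^+ 2) @[n --> \oo] --> 0.
  rewrite -[X in _ --> X](@sqrtr0 R).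
  exact: (continuous_cvg _ (@sqrt_continuous R _) cz).
apply: squeeze_cvgr; last exact: cvg_cst.
apply: nearW => n; rewrite normr_ge0/= -sqrtr_sqr.
by apply: ler_wsqrtr.
Qed.

End second_moments.

Lemma innerE {R : realType} {q k : nat} (P : probability (observation R q) R)
    (w : observation R q -> 'cV[R]_k) : inner P w w = l2norm2 P w.
Proof.
rewrite /inner unlock; apply: eq_integral => z _; congr EFin.
by rewrite mxE; apply: eq_bigr => i _; rewrite mxE expr2.
Qed.

(** * Logarithmic derivatives and paths linear up to a quadratic error *)

Section logarithmic_derivative.
Context {R : realType} {V : normedModType R}.

Lemma differentiable_ln (f : V -> R) a : differentiable f a -> 0 < f a ->
  differentiable (fun t => ln (f t)) a.
Proof.
move=> df fa; apply: differentiable_comp => //.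
by apply/derivable1_diffP; apply: ex_derive; exact: is_derive1_ln.
Qed.

Lemma derive_ln (f : V -> R) a v : differentiable f a -> 0 < f a ->
  'D_v (fun t => ln (f t)) a = (f a)^-1 * 'd f a v.
Proof.
move=> df fa; rewrite deriveE; last exact: differentiable_ln.
have dln : derivable (@ln R) (f a) 1 by apply: ex_derive; exact: is_derive1_ln.
have dln' : differentiable (@ln R) (f a) by exact/derivable1_diffP.
have /(congr1 (@^~ v)) := diff_comp df dln'.
move=> dE; apply: (eq_trans dE).
rewrite /= (deriv1E dln)/= derive1E (@derive_val _ _ _ _ _ _ _ (is_derive1_ln fa)).
by rewrite mulrC.
Qed.

(** Writes a score as a limit along a sequence, so that only countably many parameter values are
    involved. Eventual positivity is what allows the logarithm of the density to be split into a sum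
    along this sequence. *)
Lemma ln_difference_quotient (f : V -> R) a v : differentiable f a -> 0 < f a ->
  (n.+1%:R * (ln (f (a + n.+1%:R^-1 *: v)) - ln (f a))) @[n --> \oo] -->
    'D_v (fun t => ln (f t)) a /\
  \forall n \near \oo, 0 < f (a + n.+1%:R^-1 *: v).
Proof.
move=> df fa.
have h0 : (n.+1%:R^-1 : R) @[n --> \oo] --> 0 by exact: cvg_harmonic.
split.
  have /(@diff_derivable _ _ _ _ _ v) := differentiable_ln df fa.
  move=> /cvgr_dnbhsP dln.
  have := dln (fun n => n.+1%:R^-1) (conj (fun n => _) h0).
  by under eq_fun do rewrite /= invrK [_ *: v + a]addrC; apply => n; rewrite gt_eqF.
have cf : {for a, continuous f} by exact: differentiable_continuous.
have av : a + n.+1%:R^-1 *: v @[n --> \oo] --> a.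
  rewrite -[X in _ --> X]addr0 -[X in _ --> _ + X](scale0r v).
  by apply: cvgD; [exact: cvg_cst|exact: cvgZr_tmp h0].
have : f (a + n.+1%:R^-1 *: v) @[n --> \oo] --> f a by exact: continuous_cvg cf av.
by move=> /cvgr_gt; exact.
Qed.

End logarithmic_derivative.

Section quadratic_remainder.
Context {R : realType} {V : normedModType R}.

(** The bound at v = 0 forces f 0 = 0, and quadratic smallness then gives the zero differential. *)
Lemma differentiable_quadratic (f : V -> R) (K d : R) : 0 < d ->
  (forall v, `|v| < d -> `|f v| <= K * `|v| ^+ 2) -> differentiable f 0.
Proof.
move=> d0 fK.
have f0 : f 0 = 0.
  by apply/eqP; rewrite -normr_le0 (le_trans (fK 0 _)) ?normr0// expr0n mulr0.
have o0 : f \o shift 0 = cst (f 0) + (\0 : {linear V -> R}) +o_ 0 id.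
  apply/eqaddoP => e e0; near=> v.
  rewrite /= !fctE/= addr0 f0 addr0 subr0.
  have vd : `|v| < d by near: v; exact: nbhs0_lt.
  apply: (le_trans (fK _ vd)); rewrite expr2 mulrA ler_wpM2r//.
  apply: (@le_trans _ _ (`|K| * `|v|)); first by rewrite ler_wpM2r// ler_norm.
  (* [K] has no prescribed sign and may be 0, so the radius is divided by |K| + 1. *)
  have K1 : 0 < `|K| + 1 by rewrite ltr_wpDl.
  apply: (@le_trans _ _ ((`|K| + 1) * `|v|)); first by rewrite ler_wpM2r// lerDl.
  rewrite mulrC -ler_pdivlMr// ltW//.
  by near: v; apply: nbhs0_lt; rewrite divr_gt0// ltr_wpDl.
have d0' : 'd f 0 = (\0 : {linear V -> R}) :> (V -> R).
  by apply: diff_unique o0; exact: cst_continuous.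
by apply/diff_locallyP; rewrite d0'; split => //; exact: cst_continuous.
Unshelve. all: by end_near. Qed.

End quadratic_remainder.

Section score_of_linear_path.
Context {R : realType} {r : nat}.

Lemma norm_cV_coord (g : 'cV[R]_r) i : `|g i 0| <= `|g|.
Proof.
rewrite [leRHS]/Num.norm/= mx_normrE.
exact: (le_bigmax_cond _ (fun ij => `|g ij.1 ij.2|) (j := (i, 0))).
Qed.

Lemma norm_dot_le (g s : 'cV[R]_r) (B : R) : (forall i, `|s i 0| <= B) ->
  `|(g^T *m s) 0 0| <= r%:R * B * `|g|.
Proof.
move=> sB; rewrite mxE (le_trans (ler_norm_sum _ _ _))//.
apply: (@le_trans _ _ (\sum_(i < r) B * `|g|)).
  apply: ler_sum => i _; rewrite mxE normrM mulrC.
  by apply: ler_pM => //; exact: norm_cV_coord.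
by rewrite sumr_const card_ord -[leLHS]mulr_natl mulrA.
Qed.

(** The difference between [f] and the affine map is quadratically small, hence has zero
    differential; the partial derivatives are those of the affine part. *)
Lemma linear_path_score (f : 'cV[R]_r -> R) (s : 'cV[R]_r) (c K d : R) : 0 < d ->
  (forall g, `|g| < d -> `|f g - (c + (g^T *m s) 0 0)| <= K * `|g| ^+ 2) ->
  f 0 = c /\ differentiable f 0 /\ forall i, 'D_(delta_mx i 0) f 0 = s i 0.
Proof.
move=> d0 fK.
pose q (g : 'cV[R]_r) := c + (g^T *m s) 0 0.
have qE g : q g = c + \sum_(i < r) g i 0 * s i 0.
  by rewrite /q mxE; congr (_ + _); apply: eq_bigr => i _; rewrite mxE.
have f0 : f 0 = c.
  apply/eqP; rewrite -subr_eq0 -normr_le0.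
  have := fK 0; rewrite normr0 expr0n mulr0 trmx0 mul0mx mxE addr0; exact.
have dq : differentiable q 0.
  have -> : q = cst c + \sum_(i < r) (fun g : 'cV[R]_r => g i 0 * s i 0).
    by apply/funext => g; rewrite qE !fctE fct_sumE.
  apply: differentiableD => //; apply: differentiable_sum => i.
  by apply: differentiableM => //; exact: differentiable_coord.
split=> //; split.
  have -> : f = (fun g => f g - q g) + q by apply/funext => g; rewrite !fctE subrK.
  by apply: differentiableD => //; exact: (@differentiable_quadratic _ _ _ K d).
move=> i; apply: cvg_lim => //.
pose e : 'cV[R]_r := delta_mx i 0.
have qe h : q (h *: e) = c + h * s i 0.
  rewrite qE (bigD1 i)//= big1 => [|j ji]; last by rewrite !mxE (negbTE ji) mulr0 mul0r.
  by rewrite !mxE !eqxx mulr1 addr0.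
have he0 : h *: e @[h --> (0 : R)] --> (0 : 'cV[R]_r).
  rewrite [X in _ --> X](_ : _ = 0 *: e); last by rewrite scale0r.
  by apply: cvgZr_tmp; exact: cvg_id.
apply/cvgrPdist_le => eps eps0; near=> h.
have h0 : h != 0 by near: h; exact: nbhs_dnbhs_neq.
have hd : `|h *: e| < d.
  near: h; apply: nbhs_dnbhs; move/cvgr0Pnorm_lt: he0; exact.
have := fK _ hd; rewrite -/(q _) qe /= addr0 f0 normrZ => fh.
have -> : s i 0 - h^-1 *: (f (h *: delta_mx i 0) - c) =
    - (h^-1 * (f (h *: e) - (c + h * s i 0))).
  by rewrite /GRing.scale/= -/e; field.
rewrite normrN normrM normfV ler_pdivrMl ?normr_gt0//.
apply: (le_trans fh); rewrite exprMn mulrCA expr2 -[leLHS]mulrA ler_wpM2l//.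
rewrite mulrC mulrA.
rewrite -(mulrA K) -expr2; set k := K * `|e| ^+ 2; have k1 : 0 < `|k| + 1 by rewrite ltr_wpDl.
apply: (@le_trans _ _ ((`|k| + 1) * `|h|)).
  by rewrite ler_wpM2r// (le_trans (ler_norm _))// lerDl.
rewrite mulrC -ler_pdivlMr// ltW//.
by near: h; apply: dnbhs0_lt; rewrite divr_gt0// ltr_wpDl.
Unshelve. all: by end_near. Qed.

End score_of_linear_path.

(** Take a rank factorization M = C B and a left inverse D of C, so that D M = B and C D M = M.
    Symmetry gives B^T = M D^T = C (B D^T); hence the square matrix B D^T = D M D^T has rank at
    least that of B, which is its size r. *)
Lemma symmetric_mx_rank_factor (F : fieldType) (n : nat) (M : 'M[F]_n) : M^T = M ->
  exists r (C : 'M[F]_(n, r)) (D : 'M[F]_(r, n)),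
    D *m M *m D^T \in unitmx /\ C *m D *m M = M.
Proof.
move=> MT.
have [r [C [B [D [MB DC rB]]]]] : exists r (C : 'M[F]_(n, r)) (B : 'M[F]_(r, n))
    (D : 'M[F]_(r, n)), [/\ C *m B = M, D *m C = 1%:M & \rank B = r].
  have [D DC] := row_fullP (col_base_full M).
  exists (\rank M), (col_base M), (row_base M), D; split => //.
    exact: mulmx_base.
  exact/eqP/row_base_free.
have DM : D *m M = B by rewrite -MB mulmxA DC mul1mx.
exists r, C, D; split; last by rewrite -mulmxA DM.
rewrite DM -row_free_unit -row_leq_rank.
have MD : M *m D^T = B^T by rewrite -[in LHS]MT -trmx_mul DM.
have BT : B^T = C *m (B *m D^T) by rewrite mulmxA MB MD.
by have := mxrankM_maxr C (B *m D^T); rewrite -BT mxrank_tr rB.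
Qed.

(** * Square roots of perturbed densities *)

Section bounded_scores.
Context {R : realType}.

(** Transfers a relative error on a density to its square root. With t = sqrt (b / a) and u = t^2 -
    1 one has t - 1 - l / 2 = (- (t - 1)^2 + (u - l)) / 2, where |u - l| <= k and |t - 1| <= |u| <=
    |l| + k. If a = 0 the hypothesis forces b = 0. *)
Lemma sqrt_linear_remainder (a b l k : R) : 0 <= a -> 0 <= b ->
  `|b - a * (1 + l)| <= k * a ->
  (Num.sqrt b - Num.sqrt a - 2^-1 * l * Num.sqrt a) ^+ 2 <=
  (2^-1 * ((`|l| + k) ^+ 2 + k)) ^+ 2 * a.
Proof.
move=> a0 b0 bak.
have [aE|a_neq0] := eqVneq a 0.
  move: bak; rewrite aE mul0r subr0 mulr0 normr_le0 => /eqP ->.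
  by rewrite !sqrtr0 mulr0 !subr0 expr0n mulr0.
have a_gt0 : 0 < a by rewrite lt0r a_neq0.
set x := Num.sqrt a; set y := Num.sqrt b.
have x0 : 0 < x by rewrite sqrtr_gt0.
have y0 : 0 <= y by rewrite sqrtr_ge0.
have aE : a = x ^+ 2 by rewrite sqr_sqrtr.
have bE : b = y ^+ 2 by rewrite sqr_sqrtr.
pose t := y / x; have t0 : 0 <= t by rewrite divr_ge0// ltW.
have yE : y = t * x by rewrite /t divfK// gt_eqF.
pose u := t ^+ 2 - 1.
have ulk : `|u - l| <= k.
  have : b - a * (1 + l) = (u - l) * a by rewrite bE aE yE /u; ring.
  by move=> e; move: bak; rewrite e normrM (gtr0_norm a_gt0) ler_pM2r.
have k0 : 0 <= k by exact: le_trans ulk.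
have u1 : `|u| <= `|l| + k.
  have -> : u = l + (u - l) by rewrite addrC subrK.
  by apply: (le_trans (ler_normD _ _)); rewrite lerD2l.
have tu : `|t - 1| <= `|u|.
  have -> : u = (t - 1) * (t + 1) by rewrite /u; ring.
  by rewrite normrM ler_peMr// ger0_norm; lra.
have -> : y - x - 2^-1 * l * x = x * (t - 1 - 2^-1 * l) by rewrite yE; ring.
rewrite exprMn -aE mulrC ler_wpM2r// -real_normK ?num_real//.
rewrite lerXn2r ?nnegrE// ?mulr_ge0 ?addr_ge0 ?sqr_ge0//.
have -> : t - 1 - 2^-1 * l = 2^-1 * (- (t - 1) ^+ 2 + (u - l)) by rewrite /u; field.
rewrite normrM gtr0_norm// ler_pM2l//.
apply: (le_trans (ler_normD _ _)); apply: lerD => //.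
rewrite normrN normrX lerXn2r ?nnegrE ?addr_ge0//.
exact: le_trans tu u1.
Qed.

End bounded_scores.

(** * Information matrices of bounded scores *)

Section information.
Context {R : realType} {q k : nat}.
Variables (P : probability (observation R q) R) (b : observation R q -> 'cV[R]_k) (B : R).
Hypotheses (mb : measurable_vec b) (bB : forall z i, `|b z i 0| <= B).

Let mbb i j : measurable_fun setT (fun z => b z i 0 * b z j 0).
Proof. by apply: measurable_funM; exact: mb. Qed.

Let bbi i j : P.-integrable setT (fun z => (b z i 0 * b z j 0)%:E).
Proof.
apply: (measurable_bounded_integrable measurableT) => //.
  by apply: (@le_lt_trans _ _ 1%E); [exact: probability_le1|exact: ltry].
exists (B * B); split; first exact: num_real.
move=> x Bx z _; apply: (le_trans _ (ltW Bx)); rewrite normrM.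
by apply: ler_pM.
Qed.

Lemma informationE i j :
  (\int[P]_z (b z i 0 * b z j 0)%:E = (information P b i j)%:E)%E.
Proof.
rewrite mxE fineK unlock.
  by apply: eq_integral => z _; rewrite mxE big_ord1 mxE.
rewrite (_ : (fun z => _) = (fun z => (b z i 0 * b z j 0)%:E)).
  exact: (integrable_fin_num measurableT (bbi i j)).
by apply/funext => z; rewrite mxE big_ord1 mxE.
Qed.

Lemma information_mulmx_integral r (A : 'M[R]_(r, k)) i j :
  (\int[P]_z ((A *m b z) i 0 * (A *m b z) j 0)%:E =
   ((A *m information P b *m A^T) i j)%:E)%E.
Proof.
transitivity (\int[P]_z (\sum_l \sum_m (A i m * A j l)%:E * (b z m 0 * b z l 0)%:E))%E.
  apply: eq_integral => z _; rewrite !mxE mulr_sumr -sumEFin.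
  apply: eq_bigr => l _; rewrite mulr_suml -sumEFin.
  by apply: eq_bigr => m _; rewrite -EFinM; congr EFin; ring.
rewrite integral_sum//; last first.
  by move=> l; apply: integrable_sum => // m _; exact: integrableZl.
rewrite mxE -sumEFin; apply: eq_bigr => l _.
rewrite integral_sum//; last by move=> m; exact: integrableZl.
rewrite !mxE mulr_suml -sumEFin; apply: eq_bigr => m _.
by rewrite integralZl// informationE -EFinM; congr EFin; ring.
Qed.

Lemma information_mulmx r (A : 'M[R]_(r, k)) :
  information P (fun z => A *m b z) = A *m information P b *m A^T.
Proof.
apply/matrixP => i j; rewrite mxE unlock.
rewrite (_ : (fun z => _) = (fun z => ((A *m b z) i 0 * (A *m b z) j 0)%:E)).
  by rewrite information_mulmx_integral.
by apply/funext => z; rewrite mxE big_ord1 [in RHS]mxE [(_^T) _ _]mxE [in LHS]mxE.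
Qed.

(* The coordinates of b may be linearly dependent; D b is a maximal independent
   family of combinations of them. *)
Lemma nonsingular_information : exists r (C : 'M[R]_(k, r)) (D : 'M[R]_(r, k)),
  information P (fun z => D *m b z) \in unitmx /\
  {ae P, forall z, b z = C *m (D *m b z)}.
Proof.
have symM : (information P b)^T = information P b.
  apply/matrixP => i j; rewrite mxE; apply: EFin_inj; rewrite -!informationE.
  by under eq_integral do rewrite mulrC.
have [r [C [D [DMD CDM]]]] := symmetric_mx_rank_factor symM.
exists r, C, D; split; first by rewrite information_mulmx.
(* [N] annihilates the information matrix, so every coordinate of N b has second moment 0 and
   vanishes a.e. *)
pose N := 1%:M - C *m D.
have NM : N *m information P b = 0 by rewrite mulmxBl mul1mx CDM subrr.
have : {ae P, forall z, forall i, (N *m b z) i 0 = 0}.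
  apply: ae_forall_ord => i.
  have mN : measurable_fun setT (fun z => (N *m b z) i 0) by exact: measurable_vec_mulmx.
  have NN0 : (\int[P]_z `|((N *m b z) i 0 * (N *m b z) i 0)%:E| = 0)%E.
    under eq_integral do rewrite gee0_abs ?lee_fin -?expr2 ?sqr_ge0// expr2.
    by rewrite information_mulmx_integral NM mul0mx mxE.
  have mNN : measurable_fun setT (fun z => ((N *m b z) i 0 * (N *m b z) i 0)%:E).
    by apply/measurable_EFinP; exact: measurable_funM.
  have [+ _] := ae_eq_integral_abs P measurableT mNN.
  move=> /(_ NN0); apply: filterS => z /(_ I) [] /eqP.
  by rewrite mulf_eq0 orbb => /eqP.
apply: filterS => z Nz; apply/eqP; rewrite -subr_eq0; apply/eqP/matrixP => i j.
by rewrite ord1 [RHS]mxE -(Nz i) mulmxBl mul1mx mulmxA.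
Qed.

End information.

(** * Tilting a density by a bounded function *)

Section bounded_tilt.
Context {d} {T : measurableType d} {R : realType} {k : nat}.
Variables (m : {measure set T -> \bar R}) (phi : T -> R) (h : T -> 'cV[R]_k) (B c : R).
Hypotheses (mphi : measurable_fun setT phi) (phi0 : forall t, 0 <= phi t).
Hypothesis phic : (\int[m]_t (phi t)%:E = c%:E)%E.
Hypotheses (mh : measurable_vec h) (hB : forall t i, `|h t i 0| <= B).

Lemma density_integrable : m.-integrable setT (fun t => (phi t)%:E).
Proof.
apply/integrableP; split; first exact/measurable_EFinP.
by under eq_integral do rewrite /= ger0_norm//; rewrite phic ltry.
Qed.

Lemma bounded_mul_density_integrable i :
  m.-integrable setT (fun t => (h t i 0 * phi t)%:E).
Proof.
apply: (le_integrable measurableT _ _ (integrableZl measurableT B density_integrable)).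
- by apply/measurable_EFinP; apply: measurable_funM => //; exact: mh.
- move=> t _; rewrite -EFinM !abse_EFin lee_fin !normrM ler_wpM2r//.
  exact: le_trans (hB t i) (ler_norm _).
Qed.

(** Used for [g0], for the conditional densities and for [eta0]: the mass after tilting is an
    explicit affine function of [w], so all normalizing constants are computed exactly. *)
Lemma tilt_integral (w : 'cV[R]_k) :
  (\int[m]_t (phi t * (1 + (w^T *m h t) 0 0))%:E =
   (c + (w^T *m \col_i \int[m]_t (h t i 0 * phi t)) 0 0)%:E)%E.
Proof.
transitivity (\int[m]_t ((phi t)%:E + \sum_i (w i 0)%:E * (h t i 0 * phi t)%:E))%E.
  apply: eq_integral => t _; rewrite mulrDr mulr1 EFinD; congr (_ + _)%E.
  rewrite mxE mulr_sumr -sumEFin; apply: eq_bigr => i _.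
  by rewrite mxE -EFinM; congr EFin; ring.
rewrite integralD//; last 2 first.
- exact: density_integrable.
- by apply: integrable_sum => // i _; apply: integrableZl => //; exact: bounded_mul_density_integrable.
rewrite phic integral_sum//; last first.
  by move=> i; apply: integrableZl => //; exact: bounded_mul_density_integrable.
rewrite EFinD; congr (_ + _)%E; rewrite mxE -sumEFin; apply: eq_bigr => i _.
rewrite integralZl//; last exact: bounded_mul_density_integrable.
rewrite !mxE EFinM /Rintegral fineK//.
exact: (integrable_fin_num measurableT (bounded_mul_density_integrable i)).
Qed.

Lemma norm_bounded_mean i : `|\int[m]_t (h t i 0 * phi t)| <= B * c.
Proof.
apply: (le_trans (le_normr_Rintegral measurableT (bounded_mul_density_integrable i))).
rewrite -lee_fin /Rintegral fineK; last first.
  apply: (integrable_fin_num measurableT).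
  exact: (integrable_norm (bounded_mul_density_integrable i)).
rewrite EFinM -phic -integralZl//; last exact: density_integrable.
apply: ge0_le_integral => //.
- apply/measurable_EFinP; apply: measurableT_comp => //.
  by apply: measurable_funM => //; exact: mh.
- by apply: emeasurable_funM => //; exact/measurable_EFinP.
- by move=> t _; rewrite -EFinM lee_fin normrM [`|phi t|]ger0_norm// ler_wpM2r.
Qed.

End bounded_tilt.

(** The error is exactly - (u - v) v / (1 + v), and 1 / (1 + v) <= 2. Here u comes from tilting the
    numerator of a conditional density and v from its normalizer. *)
Lemma tilt_ratio_bound {R : realType} (u v : R) : `|v| <= 2^-1 ->
  `|(1 + u) / (1 + v) - (1 + (u - v))| <= 2 * ((`|u| + `|v|) * `|v|).
Proof.
rewrite ler_norml => /andP[v1 v2]; have v0 : 0 < 1 + v by lra.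
have -> : (1 + u) / (1 + v) - (1 + (u - v)) = (1 + v)^-1 * ((u - v) * - v).
  by field; rewrite gt_eqF.
rewrite normrM ler_pM// ?normfV.
- by rewrite gtr0_norm// -[leRHS]invrK lef_pV2 ?posrE//; lra.
- by rewrite normrM normrN ler_wpM2r// (le_trans (ler_normB _ _)).
Qed.

(** * Truncation *)

Section truncation.
Context {R : realType}.

Definition truncate (c t : R) : R := Num.max (- c) (Num.min c t).

Lemma truncate_bounded c t : 0 <= c -> `|truncate c t| <= c.
Proof.
move=> c0; rewrite /truncate ler_norml le_max lexx/= ge_max ge_min lexx andbT.
by rewrite (le_trans _ c0)// oppr_le0.
Qed.

Lemma truncate_id c t : `|t| <= c -> truncate c t = t.
Proof.
rewrite ler_norml /truncate => /andP[ct tc].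
by rewrite (min_idPr tc) (max_idPr ct).
Qed.

Lemma measurable_truncate c {d} {T : measurableType d} (f : T -> R) :
  measurable_fun setT f -> measurable_fun setT (fun t => truncate c (f t)).
Proof.
by move=> mf; apply: measurable_maxr => //; exact: measurable_minr.
Qed.

(** The truncation error is soft thresholding: 0 on [-c, c] and of slope 1 outside, hence
    nondecreasing and 1-Lipschitz. *)
Lemma truncation_error_lipschitz c s t : 0 <= c ->
  `|(s - truncate c s) - (t - truncate c t)| <= `|s - t|.
Proof.
move=> c0; wlog st : s t / s <= t => [H|].
  have [|ts] := leP s t; first exact: H.
  by rewrite distrC [leRHS]distrC; apply: H; exact: ltW.
have -> : `|s - t| = t - s by rewrite distrC ger0_norm ?subr_ge0.
rewrite ler_norml /truncate /Num.max /Num.min.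
by have [cs|cs] := ltP c s; have [ct|ct] := ltP c t;
  do ?(case: ifPn; rewrite -?leNgt => ?); apply/andP; split; lra.
Qed.

Lemma truncation_error_le c t : 0 <= c -> `|t - truncate c t| <= `|t|.
Proof.
move=> c0; have := truncation_error_lipschitz t 0 c0.
by rewrite [truncate c 0]truncate_id ?normr0// !subr0.
Qed.

Lemma truncation_error_cvg t : (t - truncate n%:R t) @[n --> \oo] --> 0.
Proof.
apply: cvg_near_cst; exists (Num.bound `|t|) => // n /= tn.
rewrite truncate_id ?subrr//; apply: (le_trans (ltW (archi_boundP _))) => //.
by rewrite ler_nat.
Qed.

(** [k] is only integrable against [phi], so either side may be infinite. An infinite right-hand
    side is dismissed first; otherwise (k - c)^2 is integrable and the square can be expanded. *)
Lemma variance_le {d} {T : measurableType d} (m : {measure set T -> \bar R})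
    (phi k : T -> R) (c : R) :
  measurable_fun setT phi -> (forall t, 0 <= phi t) ->
  (\int[m]_t (phi t)%:E = 1)%E -> measurable_fun setT k ->
  m.-integrable setT (fun t => (k t * phi t)%:E) ->
  (\int[m]_t ((k t - \int[m]_t (k t * phi t)) ^+ 2 * phi t)%:E <=
   \int[m]_t ((k t - c) ^+ 2 * phi t)%:E)%E.
Proof.
move=> mphi phi0 phi1 mk kphi; set M := \int[m]_t _.
have msq x : measurable_fun setT (fun t => (k t - x) ^+ 2 * phi t).
  by apply: measurable_funM => //; apply: measurable_funX; exact: measurable_funB.
have sq0 x t : 0 <= (k t - x) ^+ 2 * phi t by rewrite mulr_ge0 ?sqr_ge0.
have [->|Fy] := eqVneq (\int[m]_t ((k t - c) ^+ 2 * phi t)%:E)%E +oo%E.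
  by rewrite leey.
have Fi : m.-integrable setT (fun t => ((k t - c) ^+ 2 * phi t)%:E).
  apply/integrableP; split; first exact/measurable_EFinP.
  by under eq_integral do rewrite gee0_abs ?lee_fin//; rewrite ltey.
have phii := density_integrable mphi phi0 phi1.
have ME : (\int[m]_t (k t * phi t)%:E = M%:E)%E.
  by rewrite /M /Rintegral fineK//; exact: (integrable_fin_num measurableT kphi).
(* Pointwise (k - M)^2 = (k - c)^2 - a k + e; after integration the right-hand side loses exactly (M
   - c)^2. *)
pose a := 2 * (M - c); pose e := a * M - (M - c) ^+ 2.
have -> : (\int[m]_t ((k t - M) ^+ 2 * phi t)%:E =
    \int[m]_t (((k t - c) ^+ 2 * phi t)%:E - a%:E * (k t * phi t)%:E +
      e%:E * (phi t)%:E))%E.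
  by apply: eq_integral => t _; rewrite /e /a -!EFinM -EFinB -EFinD; congr EFin; ring.
have ai := integrableZl measurableT a kphi.
have ei := integrableZl measurableT e phii.
rewrite (integralD measurableT (integrableB measurableT Fi ai) ei).
rewrite (integralB measurableT Fi ai) (integralZl measurableT kphi).
rewrite (integralZl measurableT phii) ME phi1 mule1.
have := integrable_fin_num measurableT Fi.
case: (\int[m]_t _)%E => // F _; rewrite -EFinM -EFinB -EFinD lee_fin /e.
by have := sqr_ge0 (M - c); lra.
Qed.

(* The mean minimizes the mean square deviation, so any constant s may replace
   the mean of the truncation error. *)
Lemma truncation_variance_le {d} {T : measurableType d}
    (m : {measure set T -> \bar R}) (phi k : T -> R) (c s : R) : 0 <= c ->
  measurable_fun setT phi -> (forall t, 0 <= phi t) ->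
  (\int[m]_t (phi t)%:E = 1)%E -> measurable_fun setT k ->
  m.-integrable setT (fun t => (k t * phi t)%:E) ->
  (\int[m]_t ((k t - truncate c (k t) -
      (\int[m]_u (k u * phi u) - \int[m]_u (truncate c (k u) * phi u))) ^+ 2 *
      phi t)%:E <=
   \int[m]_t ((k t - truncate c (k t) - s) ^+ 2 * phi t)%:E)%E.
Proof.
move=> c0 mphi phi0 phi1 mk kphi.
pose e t := k t - truncate c (k t).
have me : measurable_fun setT e.
  by apply: measurable_funB => //; exact: measurable_truncate.
have ephi : m.-integrable setT (fun t => (e t * phi t)%:E).
  apply: le_integrable kphi => //.
    by apply/measurable_EFinP; exact: measurable_funM.
  move=> t _; rewrite !abse_EFin lee_fin !normrM ler_wpM2r//.
  exact: truncation_error_le.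
have -> : \int[m]_u (k u * phi u) - \int[m]_u (truncate c (k u) * phi u) =
    \int[m]_u (e u * phi u).
  have -> : \int[m]_u (truncate c (k u) * phi u) =
      \int[m]_u (k u * phi u - e u * phi u).
    by apply: eq_Rintegral => u _; rewrite /e; ring.
  by rewrite (RintegralB measurableT kphi ephi) opprB addrC subrK.
exact: (variance_le s mphi phi0 phi1 me ephi).
Qed.

Lemma l2_dominated {d} {T : measurableType d} {k : nat} (P : probability T R)
    (w : T -> 'cV[R]_k) (G : nat -> T -> 'cV[R]_k) (e : R) :
  measurable_vec w -> (l2norm2 P w < +oo)%E -> (forall n, measurable_vec (G n)) ->
  (forall n z i, `|G n z i 0| <= `|w z i 0|) ->
  (forall z i, G n z i 0 @[n --> \oo] --> 0) -> 0 < e ->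
  exists n, (l2norm2 P (G n) < e%:E)%E.
Proof.
move=> mw wfin mG Gw Gcv e0.
have mS := measurable_sumsq mw.
have S0 (u : T -> 'cV[R]_k) z : 0 <= \sum_i (u z i 0) ^+ 2.
  by apply: sumr_ge0 => i _; exact: sqr_ge0.
have := @dominated_convergence _ _ _ P setT measurableT
  (fun n z => (\sum_i (G n z i 0) ^+ 2)%:E) (cst 0%E)
  (fun z => (\sum_i (w z i 0) ^+ 2)%:E).
case.
- by move=> n; apply/measurable_EFinP; exact: measurable_sumsq.
- exact: measurable_cst.
- apply: aeW => z _; apply: cvg_EFin; first exact: nearW.
  rewrite [X in _ --> X](_ : _ = \sum_(i < k) (0 * 0 : R)); last first.
    by rewrite big1// => i _; rewrite mulr0.
  by apply: (cvg_big add_continuous) => i _; apply: cvgM; exact: Gcv.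
- apply/integrableP; split; first exact/measurable_EFinP.
  by under eq_integral do rewrite gee0_abs ?lee_fin ?S0//.
- apply: aeW => z n _; rewrite gee0_abs ?lee_fin ?S0//.
  apply: ler_sum => i _; rewrite -real_normK ?num_real// -[leRHS]real_normK ?num_real//.
  by rewrite lerXn2r ?nnegrE.
move=> _ _; rewrite integral0 => /fine_cvgP[Gfin].
move=> /cvgrPdist_lt/(_ _ e0)/(filterI Gfin)[n _ /(_ n (leqnn n))[/= fn]].
rewrite sub0r normrN => Ge; exists n; rewrite /l2norm2 -(fineK fn) lte_fin.
exact: le_lt_trans (ler_norm _) Ge.
Qed.

Lemma l2norm2_le {d} {T : measurableType d} {k : nat} (P : probability T R)
    (u v : T -> 'cV[R]_k) : measurable_vec u -> measurable_vec v ->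
  (forall i, (\int[P]_z ((u z i 0) ^+ 2)%:E <= \int[P]_z ((v z i 0) ^+ 2)%:E)%E) ->
  (l2norm2 P u <= l2norm2 P v)%E.
Proof.
move=> mu mv uv.
have sumE (w : T -> 'cV[R]_k) : measurable_vec w ->
    (l2norm2 P w = \sum_i \int[P]_z ((w z i 0) ^+ 2)%:E)%E.
  move=> mw; rewrite /l2norm2; under eq_integral do rewrite -sumEFin.
  rewrite ge0_integral_sum// => [i|i z _]; last by rewrite lee_fin sqr_ge0.
  by apply/measurable_EFinP; apply: measurable_funX; exact: mw.
by rewrite !sumE//; apply: lee_sum => i _; exact: uv.
Qed.

End truncation.

(** * Consequences of the model at the truth *)

Section truth.
Context {R : realType} {q : nat}.
Variables (nu : {sigma_finite_measure set (measurableTypeR R) -> \bar R})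
          (mu : {sigma_finite_measure set (covariate R q) -> \bar R})
          (beta0 : 'cV[R]_q) (g0 : R -> R) (eta0 : covariate R q -> R)
          (P : probability (observation R q) R).
Hypothesis truth : in_model nu mu beta0 g0 eta0.
Hypothesis P_truth : has_density nu mu P (joint_density nu beta0 g0 eta0).

Local Notation p0 := (joint_density nu beta0 g0 eta0).

Let mp0 : measurable_fun setT p0.
Proof.
by have [[mg g00 _] [me _ _] _] := truth; exact: measurable_joint_density.
Qed.

Let p0_ge0 z : 0 <= p0 z.
Proof. by have [[_ g00 _] [_ e00 _] _] := truth; exact: joint_density_ge0. Qed.

Let p0_neq0E z : p0 z != 0 -> g0 z.1 != 0 /\ eta0 z.2 != 0.
Proof.
rewrite /joint_density /cond_density !mulf_eq0 !negb_or.
by move=> /andP[/andP[/andP[_ ? _] ?]].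
Qed.

Lemma P_integral (f : observation R q -> R) :
  measurable_fun setT f -> (forall t, 0 <= f t) ->
  (\int[P]_z (f z)%:E = \int[(nu \x mu)%E]_z (f z * p0 z)%:E)%E.
Proof. exact: (product_density_integral mp0 P_truth). Qed.

Lemma P_integral_iter (f : observation R q -> R) :
  measurable_fun setT f -> (forall t, 0 <= f t) ->
  (\int[P]_z (f z)%:E = \int[mu]_x \int[nu]_y (f (y, x) * p0 (y, x))%:E)%E.
Proof.
move=> mf f0; rewrite P_integral// fubini_tonelli2//.
- by apply/measurable_EFinP; exact: measurable_funM.
- by move=> z; rewrite lee_fin mulr_ge0.
Qed.

Lemma ae_P (Q : observation R q -> Prop) :
  {ae P, forall z, Q z} <-> {ae (nu \x mu)%E, forall z, p0 z != 0 -> Q z}.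
Proof. exact: (density_ae Q mp0 p0_ge0 P_truth). Qed.

Lemma ae_P_support :
  {ae P, forall z, [/\ p0 z != 0, g0 z.1 != 0, eta0 z.2 != 0 &
                       (normalizer nu beta0 g0 z.2 < +oo)%E]}.
Proof.
have [_ _ /(product_ae_snd nu) fN] := truth.
apply/ae_P; apply: filterS fN => z fN pz; move: (pz).
by move=> /p0_neq0E[gz ez]; split=> //; exact: fN.
Qed.

Lemma ae_P_snd (Q : covariate R q -> Prop) :
  {ae mu, forall x, eta0 x != 0 -> Q x} -> {ae P, forall z, Q z.2}.
Proof.
move=> /(product_ae_snd nu) aeQ; apply/ae_P; apply: filterS aeQ => z + pz.
by apply; have [] := p0_neq0E pz.
Qed.

Lemma ae_P_fst (Q : R -> Prop) :
  {ae nu, forall y, g0 y != 0 -> Q y} -> {ae P, forall z, Q z.1}.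
Proof.
move=> /(product_ae_fst mu) aeQ; apply/ae_P; apply: filterS aeQ => z + pz.
by apply; have [] := p0_neq0E pz.
Qed.

Let p0_neq0 y x : g0 y != 0 -> eta0 x != 0 ->
  (normalizer nu beta0 g0 x < +oo)%E -> p0 (y, x) != 0.
Proof.
move=> gy ex fN; have [dg _ _] := truth.
by rewrite mulf_neq0// gt_eqF// cond_density_gt0.
Qed.

(** For almost every x with [eta0 x != 0] the normalizer is finite, and then [p0 (y, x)] is nonzero
    wherever [g0 y] is: the slice has the same support for all these x. *)
Lemma ae_P_ysection (Q : observation R q -> Prop) : {ae P, forall z, Q z} ->
  {ae mu, forall x, eta0 x != 0 -> {ae nu, forall y, g0 y != 0 -> Q (y, x)}}.
Proof.
move=> /ae_P /product_ae_ysection; have [_ _ fN] := truth.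
apply: filterS2 fN => x fN aeQ ex; apply: filterS aeQ => y + gy; apply.
by rewrite p0_neq0// fN.
Qed.

Lemma ae_P_xsection (Q : observation R q -> Prop) : {ae P, forall z, Q z} ->
  {ae nu, forall y, g0 y != 0 -> {ae mu, forall x, eta0 x != 0 -> Q (y, x)}}.
Proof.
move=> /ae_P /product_ae_xsection; have [_ _ fN] := truth.
apply: filterS => y aeQ gy; apply: filterS2 fN aeQ => x fN + ex; apply.
by rewrite p0_neq0// fN.
Qed.

(** The property does not involve y, so a single y with [g0 y != 0] in the slice is enough. *)
Lemma ae_P_sndE (Q : covariate R q -> Prop) :
  {ae P, forall z, Q z.2} -> {ae mu, forall x, eta0 x != 0 -> Q x}.
Proof.
move=> /ae_P_ysection; apply: filterS => x + ex => /(_ ex) aeQ.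
by have [dg _ _] := truth; have [] := density_neq0_ex dg aeQ.
Qed.

(** The summands [s n] and [c n] need not converge separately. Measurability is claimed for [h]
    only, a section of [a]; [k] is later identified with minus a conditional mean. *)
Lemma ae_limit_additive (D : nat -> observation R q -> R)
    (a : observation R q -> R) (s : nat -> R -> R)
    (c : nat -> covariate R q -> R) :
  measurable_fun setT a ->
  {ae P, forall z, D ^~ z @ \oo --> a z} ->
  {ae P, forall z, \forall n \near \oo, D n z = s n z.1 + c n z.2} ->
  exists (h : R -> R) (k : covariate R q -> R), measurable_fun [set: measurableTypeR R] h /\
    {ae P, forall z, a z = h z.1 + k z.2}.
Proof.
move=> ma Da Dsc; have [_ de _] := truth.
pose Q z := D ^~ z @ \oo --> a z /\
  \forall n \near \oo, D n z = s n z.1 + c n z.2.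
have aeQ : {ae P, forall z, Q z} by apply: filterS2 Da Dsc => z ? ?.
(* a (y, x) - a (y, x0) is the limit of c n x - c n x0, free of y. *)
have [x0 _ Qx0] := density_neq0_ex de (ae_P_ysection aeQ).
exists (fun y => a (y, x0)), (fun x => lim (c n x - c n x0 @[n --> \oo])).
split; first exact: measurableT_comp ma _.
apply: filterS2 aeQ (ae_P_fst Qx0) => -[y x] [/= Da1 Dsc1] [/= Da2 Dsc2].
suff : c n x - c n x0 @[n --> \oo] --> a (y, x) - a (y, x0).
  by move/cvg_lim => -> //; rewrite addrC subrK.
apply: cvg_trans (cvgB Da1 Da2); apply: near_eq_cvg.
near=> n; rewrite !fctE (near Dsc1 n)// (near Dsc2 n)//.
by rewrite opprD addrACA subrr add0r.
Unshelve. all: by end_near. Qed.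

Lemma ae_limit_snd (D : nat -> observation R q -> R)
    (a : observation R q -> R) (c : nat -> covariate R q -> R) :
  measurable_fun setT a ->
  {ae P, forall z, D ^~ z @ \oo --> a z} ->
  {ae P, forall z, \forall n \near \oo, D n z = c n z.2} ->
  exists alpha : covariate R q -> R, measurable_fun [set: covariate R q] alpha /\
    {ae P, forall z, a z = alpha z.2}.
Proof.
move=> ma Da Dc; have [dg _ _] := truth.
pose Q z := D ^~ z @ \oo --> a z /\ \forall n \near \oo, D n z = c n z.2.
have aeQ : {ae P, forall z, Q z} by apply: filterS2 Da Dc => z ? ?.
have [y0 _ Qy0] := density_neq0_ex dg (ae_P_xsection aeQ).
exists (fun x => a (y0, x)); split; first exact: measurableT_comp ma _.
apply: filterS2 aeQ (ae_P_snd Qy0) => -[y x] [/= Da1 Dc1] [/= Da2 Dc2].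
have Da3 : D n (y, x) @[n --> \oo] --> a (y0, x).
  apply: cvg_trans Da2; apply: near_eq_cvg.
  by near=> n; rewrite (near Dc1 n)// (near Dc2 n).
by rewrite -(cvg_lim _ Da1)// -(cvg_lim _ Da3).
Unshelve. all: by end_near. Qed.

(** The nonnegative case applies to each part of [f], and multiplication by [p0] >= 0 commutes with
    taking positive and negative parts. *)
Lemma P_integral_signed (f : observation R q -> R) (B : set (observation R q)) :
  measurable_fun setT f -> measurable B ->
  (\int[P]_(z in B) (f z)%:E = \int[(nu \x mu)%E]_(z in B) (f z * p0 z)%:E)%E.
Proof.
move=> mf mB.
have aux (u : observation R q -> R) : measurable_fun setT u -> (forall z, 0 <= u z) ->
    (\int[P]_(z in B) (u z)%:E = \int[(nu \x mu)%E]_(z in B) (u z * p0 z)%:E)%E.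
  move=> mu_ u0; rewrite integral_mkcond [RHS]integral_mkcond.
  transitivity (\int[P]_z (u z * \1_B z)%:E)%E.
    apply: eq_integral => z _; rewrite patchE indicE.
    by case: ifPn => _; rewrite ?mulr1 ?mulr0.
  rewrite P_integral; last 2 first.
  - by apply: measurable_funM => //; exact: measurable_indic.
  - by move=> z; rewrite mulr_ge0.
  apply: eq_integral => z _; rewrite patchE indicE.
  by case: ifPn => _; rewrite ?mulr1 ?mulr0 ?mul0r.
rewrite integralE [RHS]integralE; congr (_ - _)%E.
  transitivity (\int[P]_(z in B) (f^\+ z)%:E)%E.
    by apply: eq_integral => z _; rewrite funeposE /funrpos EFin_max.
  rewrite aux; [|exact: measurable_funrpos|by move=> z; rewrite /funrpos le_max lexx orbT].
  apply: eq_integral => z _; rewrite funeposE /funrpos -EFin_max; congr EFin.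
  by rewrite maxr_pMl// mul0r.
transitivity (\int[P]_(z in B) (f^\- z)%:E)%E.
  by apply: eq_integral => z _; rewrite funenegE /funrneg EFin_max.
rewrite aux; [|exact: measurable_funrneg|by move=> z; rewrite /funrneg le_max lexx orbT].
apply: eq_integral => z _; rewrite funenegE /funrneg -EFinN -EFin_max; congr EFin.
by rewrite maxr_pMl// mul0r mulNr.
Qed.

Lemma ae_eq_integrable {d} {T : measurableType d} (m : {measure set T -> \bar R})
    (f g : T -> R) :
  m.-integrable setT (EFin \o f) -> measurable_fun setT g ->
  {ae m, forall t, f t = g t} -> m.-integrable setT (EFin \o g).
Proof.
move=> /integrableP[mf fi] mg fg; apply/integrableP; split.
  exact/measurable_EFinP.
apply: le_lt_trans fi; rewrite le_eqVlt; apply/orP; left; apply/eqP.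
apply: ge0_ae_eq_integral => //.
- by apply: measurableT_comp => //; exact/measurable_EFinP.
- exact: measurableT_comp.
- by apply: filterS fg => t /= -> _.
Qed.

Lemma integrable_fubini_G {d1 d2} {T1 : measurableType d1} {T2 : measurableType d2}
    (m1 : {sigma_finite_measure set T1 -> \bar R})
    (m2 : {sigma_finite_measure set T2 -> \bar R}) (f : T1 * T2 -> \bar R) :
  (m1 \x m2)%E.-integrable setT f -> m2.-integrable setT (fubini_G m1 f).
Proof.
move=> fi; have mf := measurable_int _ fi.
have maf : measurable_fun setT (abse \o f) by exact: measurableT_comp.
have mG := measurable_fubini_G fi.
have [+ _] := integrable21ltyP m1 m2 mf; move=> /(_ fi) h.
apply/integrableP; split => //; apply: (le_lt_trans _ h).
apply: ge0_le_integral => //.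
- exact: measurableT_comp.
- exact: (measurable_fun_fubini_tonelli_G (m1 := m1) (abse \o f) maf (fun z => abse_ge0 _)).
- move=> x _; apply: le_abse_integral => //; exact: measurableT_comp mf _.
Qed.

(** E{a | X} = 0, in its integral form over the events {X in A}; this form passes directly to
    mean-square limits. *)
Definition cond_mean0 (a : observation R q -> R) : Prop :=
  forall A, measurable A -> (\int[P]_(z in snd @^-1` A) (a z)%:E = 0)%E.

Let measurable_snd_preimage (A : set (covariate R q)) : measurable A ->
  measurable (snd @^-1` A : set (observation R q)).
Proof. by move=> mA; rewrite -[X in measurable X]setTI; exact: measurable_snd. Qed.

(** On almost every slice h f = a f - k(x) f, with f the conditional density. The first term is
    integrable by Fubini and integrates to 0, the second is a constant times a probability density;
    this yields both integrability of h f and the value - k(x). *)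
Lemma cond_mean0_additive (a : observation R q -> R) (h : R -> R)
    (k : covariate R q -> R) :
  measurable_fun setT a -> P.-integrable setT (EFin \o a) -> cond_mean0 a ->
  measurable_fun [set: measurableTypeR R] h ->
  {ae P, forall z, a z = h z.1 + k z.2} ->
  {ae mu, forall x, eta0 x != 0 ->
    nu.-integrable setT (fun y => (h y * cond_density nu beta0 g0 y x)%:E) /\
    \int[nu]_y (h y * cond_density nu beta0 g0 y x) = - k x}.
Proof.
move=> ma ai a0 mh ahk; have [dg [me e0 e1] fN] := truth.
have [mg g00 g01] := dg.
have map : measurable_fun setT (fun z => (a z * p0 z)%:E).
  by apply/measurable_EFinP; exact: measurable_funM.
have api : (nu \x mu)%E.-integrable setT (fun z => (a z * p0 z)%:E).
  apply/integrableP; split => //; have /integrableP[_] := ai.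
  rewrite [X in (X < _)%E -> _](_ : _ = (\int[P]_z (`|a z|)%:E)%E)//.
  rewrite P_integral//; last exact: measurableT_comp.
  rewrite [X in (X < _)%E -> _](_ : _ = (\int[(nu \x mu)%E]_z `|(a z * p0 z)%:E|)%E)//.
  by apply: eq_integral => z _; rewrite abse_EFin normrM [`|p0 z|]ger0_norm.
(* The integral of a p0 over y is a function of x whose integral over every A is 0. *)
have G0 : ae_eq mu setT (fubini_G nu (fun z => (a z * p0 z)%:E)) (cst 0%E).
  apply: integral_ae_eq => //; first exact: integrable_fubini_G.
  move=> A _ mA; rewrite integral0.
  have mB := measurable_snd_preimage mA.
  have apBi : (nu \x mu)%E.-integrable setT
      ((fun z => (a z * p0 z)%:E) \_ (snd @^-1` A)).
    have := integrableS measurableT mB (@subsetT _ _) api.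
    by move/(integrable_mkcond _ mB).
  have := a0 A mA; rewrite P_integral_signed// [X in X = _ -> _]integral_mkcond.
  rewrite -(integral21_prod_meas1 apBi) => aA0; rewrite -[RHS]aA0 integral_mkcond.
  apply: eq_integral => x _; rewrite patchE; case: ifPn => xA.
    by apply: eq_integral => y _; rewrite patchE mem_set//=; exact/set_mem.
  rewrite /fubini_G integral0_eq// => y _; rewrite patchE memNset//=.
  by move=> /= Ax; move: xA; rewrite notin_setE.
apply: filterS3 fN (ae_P_ysection ahk) (filterI (ae_integrable2 api) G0) =>
  x fN ahkx [apx /(_ I) Gx] ex.
have {}fN := fN ex; have {}ahkx := ahkx ex.
pose f := cond_density nu beta0 g0 ^~ x.
have mf : measurable_fun [set: measurableTypeR R] f.
  exact: measurable_cond_density_y.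
have f0 y : 0 <= f y by exact: cond_density_ge0.
have f1 : (\int[nu]_y (f y)%:E = 1)%E by exact: cond_density_integral1.
have fi : nu.-integrable setT (EFin \o f).
  apply/integrableP; split; first exact/measurable_EFinP.
  by under eq_integral do rewrite /= ger0_norm//; rewrite f1 ltry.
have afE : (fun y => (a (y, x) * f y)%:E) =
    (fun y => ((eta0 x)^-1)%:E * (a (y, x) * p0 (y, x))%:E)%E.
  apply/funext => y; rewrite -EFinM; congr EFin.
  by rewrite /joint_density/= -/(f y); field.
have afi : nu.-integrable setT (fun y => (a (y, x) * f y)%:E).
  by rewrite afE; apply: integrableZl.
have af0 : (\int[nu]_y (a (y, x) * f y)%:E = 0)%E.
  by rewrite afE integralZl// [X in (_ * X)%E]Gx mule0.
(* The decomposition of [a] is known only where [g0] is nonzero; elsewhere [f] vanishes and both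
   sides are 0. *)
have hfE : {ae nu, forall y : measurableTypeR R, (a (y, x) * f y) - k x * f y = h y * f y}.
  have Fnu := ae_filter_ringOfSetsType nu.
  apply: filterS ahkx => y /= ahky; have [gy|gy] := eqVneq (g0 y) 0.
    have -> : f y = 0 by rewrite /f /cond_density gy mulr0 mul0r.
    by rewrite !mulr0 subr0.
  by rewrite (ahky gy) -mulrBl addrK.
have kfi : nu.-integrable setT (fun y => (k x * f y)%:E).
  by under eq_fun do rewrite EFinM; apply: integrableZl.
have mhf : measurable_fun setT (fun y => h y * f y) by exact: measurable_funM.
have hfi : nu.-integrable setT (fun y => (h y * f y)%:E).
  exact: (ae_eq_integrable (integrableB measurableT afi kfi) mhf hfE).
split => //; rewrite /Rintegral.
have -> : (\int[nu]_y (h y * f y)%:E =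
           \int[nu]_y (a (y, x) * f y - k x * f y)%:E)%E.
  apply: ae_eq_integral => //; first exact/measurable_EFinP.
    exact: (measurable_int _ (integrableB measurableT afi kfi)).
  by apply: filterS hfE => y -> _.
rewrite (integralB measurableT afi kfi)/= af0 sub0e.
under eq_integral do rewrite EFinM.
by rewrite integralZl//= f1 mule1.
Qed.

Lemma cond_mean0_additive_vec (a : observation R q -> 'cV[R]_q) :
  measurable_vec a -> (forall i, P.-integrable setT (fun z => (a z i 0)%:E)) ->
  (forall i, cond_mean0 (fun z => a z i 0)) ->
  (forall i, exists (h : R -> R) (k : covariate R q -> R),
     measurable_fun [set: measurableTypeR R] h /\
     {ae P, forall z, a z i 0 = h z.1 + k z.2}) ->
  exists h : R -> 'cV[R]_q,
    [/\ measurable_vec (T := measurableTypeR R) h,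
        {ae P, forall z, cond_integrable nu beta0 g0 h z.2} &
        {ae P, forall z, a z = h z.1 - cond_mean nu beta0 g0 h z.2}].
Proof.
move=> ma ai a0 /choice[h] /choice[k] hk.
have aex : {ae mu, forall x, eta0 x != 0 -> forall i : 'I_q,
    nu.-integrable setT (fun y => (h i y * cond_density nu beta0 g0 y x)%:E) /\
    \int[nu]_y (h i y * cond_density nu beta0 g0 y x) = - k i x}.
  apply: (@filterS _ _ _ [set x | forall i, eta0 x != 0 ->
    nu.-integrable setT (fun y => (h i y * cond_density nu beta0 g0 y x)%:E) /\
    \int[nu]_y (h i y * cond_density nu beta0 g0 y x) = - k i x]).
    by move=> x H ex i; exact: H.
  apply: ae_forall_ord => i; have [mh hki] := hk i.
  exact: (cond_mean0_additive (ma i) (ai i) (a0 i)).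
have aE : {ae P, forall z, forall i, a z i 0 = h i z.1 + k i z.2}.
  by apply: ae_forall_ord => i; have [] := hk i.
exists (fun y => \col_i h i y); split.
- by move=> i; under eq_fun do rewrite mxE; have [] := hk i.
- apply: filterS (ae_P_snd aex) => z zi i.
  by under eq_fun do rewrite mxE; have [] := zi i.
- apply: filterS2 aE (ae_P_snd aex) => z az zi.
  apply/matrixP => i j; rewrite !mxE ord1 az; congr (_ + _).
  by under eq_Rintegral do rewrite mxE; have [_ ->] := zi i; rewrite opprK.
Qed.

(** * Properties inherited by mean-square closures *)

Section closure_points.
Variable A : set (observation R q -> 'cV[R]_q).
Hypothesis AH : A `<=` hilbert P.

Let hilbert_mvec b : A b -> measurable_vec b.
Proof. by move=> /AH[]. Qed.

Lemma ms_closure_l2 a (e : R) : ms_closure P A a -> 0 < e ->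
  exists b, [/\ A b, measurable_vec (fun z => a z - b z) &
    (l2norm2 P (fun z => (a z - b z)%R) < e%:E)%E].
Proof.
move=> [[ma _ _] cA] e0; have [b Ab abe] := cA _ e0.
exists b; split=> //; first by apply: measurable_vecB => //; exact: hilbert_mvec.
by rewrite -innerE.
Qed.

Lemma ms_closure_seq a : ms_closure P A a ->
  exists2 b : nat -> observation R q -> 'cV[R]_q, (forall n, A (b n)) &
    {ae P, forall z, forall i, b n z i 0 @[n --> \oo] --> a z i 0}.
Proof.
move=> cA.
have /choice[b bP] n : exists b, [/\ A b, measurable_vec (fun z => a z - b z) &
    (l2norm2 P (fun z => (a z - b z)%R) < (1 / (2 ^ n.+1)%:R)%:E)%E].
  by apply: ms_closure_l2 => //; rewrite divr_gt0// ltr0n expn_gt0.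
exists b => [n|]; first by have [] := bP n.
have := @l2_cvg_ae _ _ _ _ P (fun n z => a z - b n z).
move=> /(_ (fun n => let: And3 _ h _ := bP n in h))
       /(_ (fun n => let: And3 _ _ h := bP n in h)).
apply: filterS => z cz i; have := cz i.
under eq_fun do rewrite !mxE.
move=> /(cvgB (cvg_cst (a z i 0))); rewrite subr0.
rewrite (_ : (fun=> _) - _ = (fun n => b n z i 0))//.
by apply/funext => n; rewrite !fctE opprB addrC subrK.
Qed.

(** The integral of a over {X in B} equals that of a - b for every approximant b, hence is
    arbitrarily small. *)
Lemma ms_closure_cond_mean0 a i :
  (forall b, A b -> cond_mean0 (fun z => b z i 0)) ->
  ms_closure P A a -> cond_mean0 (fun z => a z i 0).
Proof.
move=> A0 cA B mB; have [[ma afin _] _] := cA.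
have ai : P.-integrable setT (fun z => (a z i 0)%:E).
  by apply: l2_integrable => //; rewrite -innerE.
have mB' := measurable_snd_preimage mB.
have inB (f : observation R q -> R) : P.-integrable setT (fun z => (f z)%:E) ->
    P.-integrable (snd @^-1` B) (fun z => (f z)%:E).
  by move=> fi; exact: (integrableS measurableT mB' (@subsetT _ _) fi).
have aB := integrable_fin_num mB' (inB _ ai).
apply/eqP; rewrite -abse_eq0 -(fineK aB) abse_EFin eqe -normr_le0 normr_id.
rewrite -lee_fin -abse_EFin fineK// ; apply/lee_addgt0Pr => e e0; rewrite add0e.
have [b [Ab mab abe]] := ms_closure_l2 cA (exprn_gt0 2 e0).
have [mb bfin _] := AH Ab.
have bi : P.-integrable setT (fun z => (b z i 0)%:E).
  by apply: l2_integrable => //; rewrite -innerE.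
apply: le_trans (l2_integral_bound i mab mB' e0 abe).
under [in leRHS]eq_integral do rewrite !mxE EFinB.
by rewrite (integralB mB' (inB _ ai) (inB _ bi)) (A0 _ Ab _ mB) sube0.
Qed.

(** [ae_limit_additive] serves twice: here for a sequence approximating a point of the closure, and
    below for difference quotients of log densities. *)
Lemma ms_closure_additive a i :
  (forall b, A b -> exists (h : R -> R) (k : covariate R q -> R),
     {ae P, forall z, b z i 0 = h z.1 + k z.2}) ->
  ms_closure P A a -> exists (h : R -> R) (k : covariate R q -> R),
    measurable_fun [set: measurableTypeR R] h /\
    {ae P, forall z, a z i 0 = h z.1 + k z.2}.
Proof.
move=> Ahk cA; have [[ma _ _] _] := cA; have [b Ab bcv] := ms_closure_seq cA.
have /choice[h /choice[k hk]] n := Ahk _ (Ab n).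
apply: (@ae_limit_additive (fun n z => b n z i 0) _ h k); first exact: ma.
- by apply: filterS bcv => z; exact.
- apply: filterS (ae_foralln hk) => z Hz; exact: nearW.
Qed.

Lemma ms_closure_snd a i :
  (forall b, A b -> exists k : covariate R q -> R,
     {ae P, forall z, b z i 0 = k z.2}) ->
  ms_closure P A a -> exists k : covariate R q -> R,
    measurable_fun [set: covariate R q] k /\
    {ae P, forall z, a z i 0 = k z.2}.
Proof.
move=> Ahk cA; have [[ma _ _] _] := cA; have [b Ab bcv] := ms_closure_seq cA.
have /choice[k hk] n := Ahk _ (Ab n).
apply: (@ae_limit_snd (fun n z => b n z i 0) _ k); first exact: ma.
- by apply: filterS bcv => z; exact.
- apply: filterS (ae_foralln hk) => z Hz; exact: nearW.
Qed.

End closure_points.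

(** * Scores of nuisance submodels *)

Section scores.
Context {r : nat}.
Implicit Types S : observation R q -> 'cV[R]_r.

(** Grouped so that the only term mixing x and y does not involve [g] or [eta]: it cancels from
    difference quotients along a submodel, leaving a function of y plus a function of x. *)
Let ln_joint_density g eta z : (forall y, 0 <= g y) -> (forall x, 0 <= eta x) ->
  0 < joint_density nu beta0 g eta z ->
  ln (joint_density nu beta0 g eta z) = dot beta0 z.2 * z.1 +
    (ln (g z.1) + ln (eta z.2 / fine (normalizer nu beta0 g z.2))).
Proof.
move=> g_ge0 e_ge0; rewrite /joint_density /cond_density -mulrA.
rewrite [(fine _)^-1 * _]mulrC; set e := expR _; set c := eta _ / _ => pz.
have ge : 0 < e * g z.1.
  rewrite lt0r mulr_ge0 ?expR_ge0// andbT; apply/negP => /eqP e0.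
  by move: pz; rewrite e0 mul0r ltxx.
have g_gt0 : 0 < g z.1 by move: ge; rewrite pmulr_rgt0 ?expR_gt0.
have c0 : 0 < c by move: pz; rewrite pmulr_rgt0.
by rewrite lnM ?posrE// lnM ?posrE ?expR_gt0// expRK addrA.
Qed.

Let score_difference_quotient (p : 'cV[R]_r -> observation R q -> R) (gamma0 : 'cV[R]_r) S i :
  p gamma0 = p0 -> is_score P p gamma0 S ->
  {ae P, forall z, [/\ 0 < p gamma0 z,
    n.+1%:R * (ln (p (gamma0 + n.+1%:R^-1 *: delta_mx i 0) z) - ln (p gamma0 z))
      @[n --> \oo] --> S z i 0 &
    \forall n \near \oo, 0 < p (gamma0 + n.+1%:R^-1 *: delta_mx i 0) z]}.
Proof.
move=> pE; apply: filterS2 ae_P_support => z [pz _ _ _] [dp SE].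
have pz0 : 0 < p gamma0 z by rewrite pE lt0r pz p0_ge0.
by have [? ?] := ln_difference_quotient (delta_mx i 0) dp pz0; rewrite SE.
Qed.

Lemma submodel_g_score_additive (g : 'cV[R]_r -> R -> R) (gamma0 : 'cV[R]_r) S i :
  submodel_g nu mu P beta0 g0 eta0 g gamma0 S ->
  exists (h : R -> R) (k : covariate R q -> R),
    {ae P, forall z, S z i 0 = h z.1 + k z.2}.
Proof.
move=> [inm gE [mS score _ _ _]].
pose p gamma := joint_density nu beta0 (g gamma) eta0.
have pE : p gamma0 = p0 by rewrite /p gE.
pose t n : 'cV[R]_r := gamma0 + n.+1%:R^-1 *: delta_mx i 0.
pose s n y := n.+1%:R * (ln (g (t n) y) - ln (g gamma0 y)).
pose w gamma x := ln (eta0 x / fine (normalizer nu beta0 (g gamma) x)).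
pose c n x := n.+1%:R * (w (t n) x - w gamma0 x).
have dq := score_difference_quotient i pE score.
have [] := @ae_limit_additive
  (fun n z => n.+1%:R * (ln (p (t n) z) - ln (p gamma0 z))) (fun z => S z i 0) s c.
- exact: mS.
- by apply: filterS dq => z [].
- apply: filterS dq => z [pz _ pn].
  near=> n.
  have [[_ e0 _] [[_ gn0 _] _ _] [[_ gg0 _] _ _]] :
    [/\ is_density mu eta0, in_model nu mu beta0 (g (t n)) eta0 &
        in_model nu mu beta0 (g gamma0) eta0] by split=> //; have [] := truth.
  rewrite !ln_joint_density//; last by near: n.
  by rewrite /s /c /w -mulrDr; congr (_ * _); ring.
- by move=> h [k [_ hk]]; exists h, k.
Unshelve. all: by end_near. Qed.

Lemma submodel_eta_score_snd (eta : 'cV[R]_r -> covariate R q -> R) (gamma0 : 'cV[R]_r) S i :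
  submodel_eta nu mu P beta0 g0 eta0 eta gamma0 S ->
  exists k : covariate R q -> R, {ae P, forall z, S z i 0 = k z.2}.
Proof.
move=> [inm eE [mS score _ _ _]].
pose p gamma := joint_density nu beta0 g0 (eta gamma).
have pE : p gamma0 = p0 by rewrite /p eE.
pose t n : 'cV[R]_r := gamma0 + n.+1%:R^-1 *: delta_mx i 0.
pose c n x := n.+1%:R * (ln (eta (t n) x) - ln (eta gamma0 x)).
have dq := score_difference_quotient i pE score.
have [] := @ae_limit_snd
  (fun n z => n.+1%:R * (ln (p (t n) z) - ln (p gamma0 z))) (fun z => S z i 0) c.
- exact: mS.
- by apply: filterS dq => z [].
- apply: filterS dq => z [pz _ pn].
  near=> n.
  have cd0 : 0 <= cond_density nu beta0 g0 z.1 z.2.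
    by have [[_ g00 _] _ _] := truth; exact: cond_density_ge0.
  have cd : 0 < cond_density nu beta0 g0 z.1 z.2.
    rewrite lt0r cd0 andbT; apply/negP => /eqP cE.
    by move: pz; rewrite /p /joint_density cE mul0r ltxx.
  have pt : 0 < p (t n) z by near: n.
  move: pz pt; rewrite /c /p /joint_density; set k := cond_density _ _ _ _ _ in cd *.
  rewrite !(pmulr_rgt0 _ cd) => ez et.
  rewrite (lnM cd et) (lnM cd ez).
  by congr (_ * _); ring.
- by move=> k [_ hk]; exists k.
Unshelve. all: by end_near. Qed.

(** Along the line through [gamma0] in direction i the mass of {X in A} is always the integral of
    [eta0] over A, so [dqm_score_mean0] applies to this one-dimensional path. *)
Lemma submodel_g_score_cond_mean0 (g : 'cV[R]_r -> R -> R) (gamma0 : 'cV[R]_r) S i :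
  submodel_g nu mu P beta0 g0 eta0 g gamma0 S -> cond_mean0 (fun z => S z i 0).
Proof.
move=> [inm gE [mS score Sfin _ dqm]] A mA.
have mB := measurable_snd_preimage mA.
pose p (t : R) := joint_density nu beta0 (g (gamma0 + t *: delta_mx i 0)) eta0.
have pE : p 0 = p0 by rewrite /p scale0r addr0 gE.
have SP : (\int[(nu \x mu)%E]_z (S z i 0 ^+ 2 * p0 z)%:E < +oo)%E.
  rewrite -P_integral; last 2 first.
  - by apply: measurable_funX; exact: mS.
  - by move=> z; exact: sqr_ge0.
  move: Sfin; rewrite innerE; apply: le_lt_trans; apply: ge0_le_integral => //.
  - by move=> z _; rewrite lee_fin sqr_ge0.
  - by apply/measurable_EFinP; apply: measurable_funX; exact: mS.
  - by apply/measurable_EFinP; exact: measurable_sumsq.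
  - move=> z _; rewrite lee_fin (bigD1 i)//= lerDl.
    by apply: sumr_ge0 => j _; exact: sqr_ge0.
rewrite (P_integral_signed (mS i) mB).
have := @dqm_score_mean0 _ _ _ (nu \x mu)%E p (fun z => S z i 0) (snd @^-1` A).
rewrite pE => /(_ _ _ (mS i) mB _ SP); apply.
- move=> t; have [[mg g_ge0 _] [me _ _] _] := inm (gamma0 + t *: delta_mx i 0).
  exact: measurable_joint_density.
- move=> t z; have [[_ g_ge0 _] [_ e_ge0 _] _] := inm (gamma0 + t *: delta_mx i 0).
  exact: joint_density_ge0.
- by rewrite -(P_truth measurableT) probability_setT.
- have marg t : (\int[(nu \x mu)%E]_(z in snd @^-1` A) (p t z)%:E =
      \int[mu]_x (\1_A x * eta0 x)%:E)%E.
    rewrite -(joint_density_marginal (inm (gamma0 + t *: delta_mx i 0))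
      (measurable_indic mA) (fun x => _)); last by move=> x; rewrite indicE.
    rewrite integral_mkcond; apply: eq_integral => z _.
    rewrite patchE indicE (_ : (z \in snd @^-1` A) = (z.2 \in A)).
      by case: ifPn => _; rewrite ?mul1r ?mul0r.
    by apply/idP/idP => /set_mem ?; exact/mem_set.
  by move=> t; rewrite marg -pE marg.
(* The increment has squared norm k^2 t^2, so the accuracy [e] is divided by 1 + k^2. *)
- move=> e e0; pose k : R := `|delta_mx i 0 : 'cV[R]_r|.
  have k2 : 0 < 1 + k ^+ 2 by rewrite ltr_pwDl// sqr_ge0.
  have ct : gamma0 + t *: delta_mx i 0 @[t --> (0 : R)] --> gamma0.
    rewrite [X in _ --> X](_ : _ = gamma0 + 0 *: delta_mx i 0 :> 'cV[R]_r); last first.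
      by rewrite scale0r addr0.
    by apply: cvgD; [exact: cvg_cst|apply: cvgZr_tmp; exact: cvg_id].
  pose G (theta : 'cV[R]_r) := (\int[(nu \x mu)%E]_z
    ((Num.sqrt (joint_density nu beta0 (g theta) eta0 z)
      - Num.sqrt (joint_density nu beta0 (g gamma0) eta0 z)
      - 2^-1 * ((theta - gamma0)^T *m S z) 0 0
        * Num.sqrt (joint_density nu beta0 (g gamma0) eta0 z)) ^+ 2)%:E
    <= (e / (1 + k ^+ 2) * `|theta - gamma0| ^+ 2)%:E)%E.
  have G0 : \forall t \near (0 : R), G (gamma0 + t *: delta_mx i 0).
    exact: (ct _ (dqm _ (divr_gt0 e0 k2))).
  apply: filterS G0 => t; rewrite /G gE.
  rewrite addrAC subrr add0r.
  have eqz z : ((t *: (delta_mx i 0 : 'cV[R]_r))^T *m S z) 0 0 = t * S z i 0.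
    rewrite mxE (bigD1 i)//= !mxE !eqxx mulr1 big1 ?addr0// => j ji.
    by rewrite !mxE (negbTE ji) mulr0 mul0r.
  move=> Gt; apply: (le_trans _ (le_trans Gt _)).
    rewrite le_eqVlt; apply/orP; left; apply/eqP; apply: eq_integral => z _.
    by congr (((_ - (_ * _ * _)) ^+ 2)%:E); exact/esym/eqz.
  rewrite lee_fin normrZ exprMn real_normK ?num_real//.
  rewrite mulrCA [leRHS]mulrC ler_wpM2l ?sqr_ge0// -mulrA.
  apply: ler_piMr; first exact: ltW.
  by rewrite ler_pdivrMl// mulr1 -/k lerDr.
Qed.

End scores.

Lemma nuisance_score_g_additive b i : nuisance_scores_g nu mu P beta0 g0 eta0 b ->
  exists (h : R -> R) (k : covariate R q -> R),
    {ae P, forall z, b z i 0 = h z.1 + k z.2}.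
Proof.
move=> [_ [r [g [gamma0 [S [C [sub bE]]]]]]].
have /choice[h /choice[k hk]] j := submodel_g_score_additive j sub.
exists (fun y => \sum_j C i j * h j y), (fun x => \sum_j C i j * k j x).
apply: filterS2 bE (ae_forall_ord hk) => z -> Sz; rewrite mxE -big_split/=.
by apply: eq_bigr => j _; rewrite Sz mulrDr.
Qed.

Lemma score_combination_cond_mean0 {r : nat} (b : observation R q -> 'cV[R]_q) i
    (g : 'cV[R]_r -> R -> R) (gamma0 : 'cV[R]_r) S (C : 'M[R]_(q, r)) :
  measurable_vec b -> submodel_g nu mu P beta0 g0 eta0 g gamma0 S ->
  {ae P, forall z, b z = C *m S z} -> cond_mean0 (fun z => b z i 0).
Proof.
move=> mb sub bE A mA.
have [_ _ [mS _ Sfin _ _]] := sub.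
have mB := measurable_snd_preimage mA.
have Si j : P.-integrable (snd @^-1` A) (fun z => (S z j 0)%:E).
  apply: (integrableS measurableT mB (@subsetT _ _)).
  by apply: l2_integrable => //; rewrite -innerE.
transitivity (\int[P]_(z in snd @^-1` A) (\sum_j (C i j)%:E * (S z j 0)%:E))%E.
  apply: ae_eq_integral => //.
  - by apply: measurable_funTS; apply/measurable_EFinP; exact: mb.
  - apply: emeasurable_sum => j; apply: emeasurable_funM => //.
    exact: measurable_int (Si j).
  - apply: filterS bE => z -> _; rewrite mxE -sumEFin.
    by apply: eq_bigr => j _; rewrite EFinM.
rewrite integral_sum//; last by move=> j; exact: integrableZl.
apply: big1 => j _; rewrite integralZl//.
by rewrite (submodel_g_score_cond_mean0 j sub) ?mule0.
Qed.

Lemma nuisance_score_eta_snd b i : nuisance_scores_eta nu mu P beta0 g0 eta0 b ->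
  exists k : covariate R q -> R, {ae P, forall z, b z i 0 = k z.2}.
Proof.
move=> [_ [r [eta [gamma0 [S [C [sub bE]]]]]]].
have /choice[k hk] j := submodel_eta_score_snd j sub.
exists (fun x => \sum_j C i j * k j x).
apply: filterS2 bE (ae_forall_ord hk) => z -> Sz; rewrite mxE.
by apply: eq_bigr => j _; rewrite Sz.
Qed.

Lemma Lambda1_sub a : Lambda1 nu mu P beta0 g0 eta0 a ->
  exists h : R -> 'cV[R]_q,
    [/\ measurable_vec (T := measurableTypeR R) h,
        {ae P, forall z, cond_integrable nu beta0 g0 h z.2} &
        {ae P, forall z, a z = h z.1 - cond_mean nu beta0 g0 h z.2}].
Proof.
move=> La; have [[ma afin _] _] := La.
have AH : nuisance_scores_g nu mu P beta0 g0 eta0 `<=` hilbert P by move=> b [].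
apply: cond_mean0_additive_vec => // i.
- by apply: l2_integrable => //; rewrite -innerE.
- apply: (ms_closure_cond_mean0 AH) La => b [[mb _ _]].
  by move=> [r [g [gamma0 [S [C [sub bE]]]]]]; exact: score_combination_cond_mean0 sub bE.
- by apply: (ms_closure_additive AH) La => b; exact: nuisance_score_g_additive.
Qed.

Lemma Lambda2_sub a : Lambda2 nu mu P beta0 g0 eta0 a ->
  exists alpha : covariate R q -> 'cV[R]_q,
    [/\ measurable_vec alpha,
        (forall i, ('E_P[(fun z => alpha z.2 i 0)%R] = 0)%E) &
        {ae P, forall z, a z = alpha z.2}].
Proof.
move=> La; have [[ma _ a0] _] := La.
have AH : nuisance_scores_eta nu mu P beta0 g0 eta0 `<=` hilbert P by move=> b [].
have /choice[alpha alphaP] i := ms_closure_snd AH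
  (fun b (Ab : nuisance_scores_eta nu mu P beta0 g0 eta0 b) => nuisance_score_eta_snd i Ab) La.
have aE : {ae P, forall z, a z = \col_i alpha i z.2}.
  have /ae_forall_ord : forall i, {ae P, forall z, a z i 0 = alpha i z.2}.
    by move=> i; have [] := alphaP i.
  apply: filterS => z az; apply/matrixP => i j.
  by rewrite ord1 az mxE.
exists (fun x => \col_i alpha i x); split => //.
- by move=> i; under eq_fun do rewrite mxE; have [] := alphaP i.
- move=> i; rewrite -[RHS](a0 i) unlock; apply: ae_eq_integral => //.
  + apply/measurable_EFinP; under eq_fun do rewrite mxE.
    by apply: measurableT_comp => //; have [] := alphaP i.
  + by apply/measurable_EFinP; exact: ma.
  + by apply: filterS aE => z -> _.
Qed.

(** * Regularity of paths linear up to a quadratic relative error *)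

Lemma integral_p0 : (\int[(nu \x mu)%E]_z (p0 z)%:E = 1)%E.
Proof. by rewrite -(P_truth measurableT) probability_setT. Qed.

Lemma l2norm2_bounded {k : nat} (w : observation R q -> 'cV[R]_k) (B : R) :
  measurable_vec w -> (forall z i, `|w z i 0| <= B) -> (l2norm2 P w < +oo)%E.
Proof.
move=> mw wB; have mS := measurable_sumsq mw.
have : P.-integrable setT (EFin \o (fun z => \sum_i (w z i 0) ^+ 2)).
  apply: measurable_bounded_integrable => //.
    by apply: (@le_lt_trans _ _ 1%E); [exact: probability_le1|exact: ltry].
  exists (\sum_(i < k) B ^+ 2); split; first exact: num_real.
  move=> x Bx z _; apply: (le_trans _ (ltW Bx)).
  rewrite ger0_norm; last by apply: sumr_ge0 => i _; exact: sqr_ge0.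
  apply: ler_sum => i _; rewrite -real_normK ?num_real// lerXn2r ?nnegrE//.
  exact: le_trans (normr_ge0 _) (wB z i).
move=> /integrableP[_]; apply: le_lt_trans; rewrite le_eqVlt; apply/orP; left.
apply/eqP; rewrite /l2norm2; apply: eq_integral => z _; rewrite /= ger0_norm//.
by apply: sumr_ge0 => i _; exact: sqr_ge0.
Qed.

Section linear_paths.
Context {r : nat}.
Variables (p : 'cV[R]_r -> observation R q -> R) (S : observation R q -> 'cV[R]_r).
Variables (B K d : R).
Hypotheses (mS : measurable_vec S) (SB : forall z i, `|S z i 0| <= B).
Hypotheses (mp : forall gamma, measurable_fun setT (p gamma))
  (p_ge0 : forall gamma z, 0 <= p gamma z) (pE : p 0 = p0).
Hypotheses (K0 : 0 <= K) (d0 : 0 < d).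
(** One null set serves all gamma at once, as the pointwise score requires; the factor [p0 z] on the
    right makes the error integrable, as mean-square differentiability requires. *)
Hypothesis p_linear : {ae (nu \x mu)%E, forall z, forall gamma, `|gamma| < d ->
  `|p gamma z - p0 z * (1 + (gamma^T *m S z) 0 0)| <= K * `|gamma| ^+ 2 * p0 z}.

Lemma linear_path_is_score : is_score P p 0 S.
Proof.
have aeP : {ae P, forall z, forall gamma, `|gamma| < d ->
  `|p gamma z - p0 z * (1 + (gamma^T *m S z) 0 0)| <= K * `|gamma| ^+ 2 * p0 z}.
  by apply/ae_P; apply: filterS p_linear => z Hz _.
apply: filterS2 aeP ae_P_support => z pz [pz0 _ _ _].
have p0z : 0 < p0 z by rewrite lt0r pz0 p0_ge0.
have [f0 [df Df]] : p 0 z = p0 z /\ differentiable (p ^~ z) 0 /\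
    forall i, 'D_(delta_mx i 0) (p ^~ z) 0 = (p0 z *: S z) i 0.
  apply: (@linear_path_score _ _ _ _ _ (K * p0 z) d) => // gamma gd.
  have -> : (gamma^T *m (p0 z *: S z)) 0 0 = p0 z * (gamma^T *m S z) 0 0.
    by rewrite -scalemxAr mxE.
  by have := pz _ gd; rewrite mulrDr mulr1 [K * p0 z * _]mulrAC.
split=> // i; rewrite derive_ln ?f0// -deriveE// Df mxE.
by rewrite mulrA mulVf ?mul1r.
Qed.

Lemma linear_path_diff_in_ms : diff_in_ms nu mu p 0 S.
Proof.
(* For |gamma| <= 1, [sqrt_linear_remainder] with |l| <= r |B| |gamma| and k = K |gamma|^2 bounds
   the squared remainder by L^2 |gamma|^4 [p0]. The last entry of [d'] makes L^2 |gamma|^2 at most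
   e. *)
move=> e e0; pose L := 2^-1 * ((r%:R * `|B| + K) ^+ 2 + K).
have L0 : 0 <= L by rewrite mulr_ge0 ?addr_ge0 ?sqr_ge0.
have L1 : 0 < L ^+ 2 + 1 by rewrite ltr_wpDl// sqr_ge0.
pose d' := Num.min d (Num.min 1 (e / (L ^+ 2 + 1))).
have d'0 : 0 < d' by rewrite !lt_min d0 ltr01/= divr_gt0.
have near_d' : \forall gamma \near (0 : 'cV[R]_r), `|gamma| < d'.
  exact: (@nbhs0_lt R 'cV[R]_r).
apply: filterS near_d' => gamma; rewrite subr0.
rewrite !lt_min => /and3P[gd g1 ge]; rewrite pE.
have rem : {ae (nu \x mu)%E, forall z,
   (Num.sqrt (p gamma z) - Num.sqrt (p0 z)
     - 2^-1 * (gamma^T *m S z) 0 0 * Num.sqrt (p0 z)) ^+ 2 <=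
   (L * `|gamma| ^+ 2) ^+ 2 * p0 z}.
  apply: filterS p_linear => z /(_ _ gd) pz.
  apply: (le_trans (sqrt_linear_remainder (p0_ge0 z) (p_ge0 gamma z) pz)).
  rewrite ler_wpM2r// lerXn2r ?nnegrE//.
  - by rewrite mulr_ge0 ?addr_ge0 ?sqr_ge0 ?mulr_ge0.
  - by rewrite mulr_ge0.
  rewrite /L -mulrA ler_pM2l// mulrDl lerD2r -exprMn lerXn2r ?nnegrE//.
  - by rewrite addr_ge0 ?mulr_ge0.
  - by rewrite mulr_ge0 ?addr_ge0 ?mulr_ge0.
  rewrite mulrDl; apply: lerD.
    by apply: norm_dot_le => i; exact: le_trans (SB z i) (ler_norm _).
  by rewrite expr2 mulrA ler_piMr ?mulr_ge0// ltW.
have mdot : measurable_fun setT (fun z => (gamma^T *m S z) 0 0).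
  exact: (measurable_vec_mulmx gamma^T mS 0).
have msq (u : observation R q -> R) : measurable_fun setT u ->
    measurable_fun setT (fun z => Num.sqrt (u z)).
  by move=> mu_; exact: measurableT_comp (continuous_measurable_fun (@sqrt_continuous R)) mu_.
apply: (@le_trans _ _ (\int[(nu \x mu)%E]_z ((L * `|gamma| ^+ 2) ^+ 2 * p0 z)%:E)%E).
  apply: ae_ge0_le_integral => //.
  - by move=> z _; rewrite lee_fin sqr_ge0.
  - apply/measurable_EFinP; apply: measurable_funX; apply: measurable_funB.
      by apply: measurable_funB; exact: msq.
    by apply: measurable_funM; [exact: measurable_funM|exact: msq].
  - by move=> z _; rewrite lee_fin mulr_ge0 ?sqr_ge0.
  - by apply/measurable_EFinP; exact: measurable_funM.
  - by apply: filterS rem => z rz _; rewrite lee_fin.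
under eq_integral do rewrite EFinM.
rewrite ge0_integralZl//; last 3 first.
- exact/measurable_EFinP.
- by move=> z _; rewrite lee_fin.
- by rewrite lee_fin sqr_ge0.
rewrite integral_p0 mule1 lee_fin exprMn [(`|gamma| ^+ 2) ^+ 2]expr2 mulrA.
rewrite ler_wpM2r ?sqr_ge0//.
have -> : `|gamma| ^+ 2 = `|gamma| * `|gamma| by rewrite expr2.
move: ge; rewrite ltr_pdivlMr// => ge.
have := normr_ge0 gamma; set n := `|gamma| in g1 ge *; move=> n0.
have := sqr_ge0 L; set L2 := L ^+ 2 in ge *; move=> L20.
by nra.
Qed.

End linear_paths.

Lemma norm_mulmx_le {r k : nat} (A : 'M[R]_(k, r)) (v : 'cV[R]_r) :
  `|A *m v| <= r%:R * `|A| * `|v|.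
Proof.
rewrite [leLHS]/Num.norm/= mx_normrE; apply: bigmax_le => [|[i j] _].
  by rewrite !mulr_ge0.
rewrite /= ord1 mxE (le_trans (ler_norm_sum _ _ _))//.
apply: (@le_trans _ _ (\sum_(l < r) `|A| * `|v|)).
  apply: ler_sum => l _; rewrite normrM; apply: ler_pM => //.
    rewrite [leRHS]/Num.norm/= mx_normrE.
    exact: (le_bigmax_cond _ (fun ij => `|A ij.1 ij.2|) (j := (i, l))).
  exact: norm_cV_coord.
by rewrite sumr_const card_ord -[leLHS]mulr_natl mulrA.
Qed.

(** Substituting w = D^T gamma turns the score b into D b, because (D^T gamma)^T b = gamma^T (D b).
    The [D] of [nonsingular_information] makes the information invertible, and [C] recovers b. *)
Lemma regular_reparametrization (p : 'cV[R]_q -> observation R q -> R)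
    (b : observation R q -> 'cV[R]_q) (B K d : R) :
  measurable_vec b -> (forall z i, `|b z i 0| <= B) ->
  (forall w, measurable_fun setT (p w)) -> (forall w z, 0 <= p w z) -> p 0 = p0 ->
  0 <= K -> 0 < d ->
  {ae (nu \x mu)%E, forall z, forall w, `|w| < d ->
    `|p w z - p0 z * (1 + (w^T *m b z) 0 0)| <= K * `|w| ^+ 2 * p0 z} ->
  exists r (C : 'M[R]_(q, r)) (D : 'M[R]_(r, q)),
    regular nu mu P (fun gamma : 'cV[R]_r => p (D^T *m gamma)) 0 (fun z => D *m b z) /\
    {ae P, forall z, b z = C *m (D *m b z)}.
Proof.
move=> mb bB mp p_ge0 pE K0 d0 plin.
have [r [C [D [Dinfo bCD]]]] := nonsingular_information P mb bB.
exists r, C, D; split => //.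
have mDb := measurable_vec_mulmx D mb.
(* The [+ 1] keeps [c] positive when r = 0 or D = 0, since the radius becomes d / c. *)
pose c := r%:R * `|D^T| + 1.
have c0 : 0 < c by rewrite ltr_wpDl// mulr_ge0.
have wle (gamma : 'cV[R]_r) : `|D^T *m gamma| <= c * `|gamma|.
  by apply: (le_trans (norm_mulmx_le _ _)); rewrite ler_wpM2r// lerDl.
have DB z i : `|(D *m b z) i 0| <= q%:R * `|D| * `|B|.
  apply: (le_trans (norm_cV_coord _ _)); apply: (le_trans (norm_mulmx_le _ _)).
  rewrite ler_wpM2l ?mulr_ge0// [leLHS]/Num.norm/= mx_normrE.
  apply: bigmax_le => [|[j l] _]; first exact: normr_ge0.
  by rewrite /= ord1; exact: le_trans (bB z j) (ler_norm _).
pose p' (gamma : 'cV[R]_r) := p (D^T *m gamma).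
have p'E : p' 0 = p0 by rewrite /p' mulmx0.
have K'0 : 0 <= K * c ^+ 2 by rewrite mulr_ge0 ?sqr_ge0.
have d'0 : 0 < d / c by rewrite divr_gt0.
have plin' : {ae (nu \x mu)%E, forall z, forall gamma, `|gamma| < d / c ->
    `|p' gamma z - p0 z * (1 + (gamma^T *m (D *m b z)) 0 0)| <=
    K * c ^+ 2 * `|gamma| ^+ 2 * p0 z}.
  apply: filterS plin => z pz gamma gd.
  have wd : `|D^T *m gamma| < d.
    by apply: le_lt_trans (wle gamma) _; rewrite mulrC -ltr_pdivlMr.
  have := pz _ wd; rewrite trmx_mul trmxK -mulmxA => /le_trans; apply.
  rewrite ler_wpM2r// -mulrA ler_wpM2l// -exprMn lerXn2r ?nnegrE//.
  by rewrite mulr_ge0// ltW.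
have mp' gamma : measurable_fun setT (p' gamma) by exact: mp.
have p'_ge0 gamma z : 0 <= p' gamma z by exact: p_ge0.
split => //.
- exact: linear_path_is_score d'0 plin'.
- by rewrite innerE; exact: (l2norm2_bounded mDb DB).
- exact: (linear_path_diff_in_ms mDb DB mp' p'_ge0 p'E K'0 d'0 plin').
Qed.

(** Tonelli is applied to the positive and negative parts, which also covers the x where h is not
    integrable and [fine] may return its default value. *)
Lemma measurable_cond_mean (h : R -> 'cV[R]_q) :
  measurable_vec (T := measurableTypeR R) h ->
  measurable_vec (cond_mean nu beta0 g0 h).
Proof.
move=> mh i; have [[mg g00 _] _ _] := truth.
pose f (z : observation R q) := (h z.1 i 0 * cond_density nu beta0 g0 z.1 z.2)%:E.
have mf : measurable_fun setT f.
  apply/measurable_EFinP; apply: measurable_funM; last exact: measurable_cond_density.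
  exact: (measurableT_comp (mh i) measurable_fst).
rewrite (_ : (fun x => _) = fine \o (fubini_G nu f^\+ \- fubini_G nu f^\-)%E); last first.
  apply/funext => x; rewrite mxE /Rintegral /= integralE.
  by congr (fine (_ - _)%E); apply: eq_integral => y _; rewrite ?funeposE ?funenegE.
apply: measurableT_comp => //.
apply: emeasurable_funB; apply: measurable_fun_fubini_tonelli_G => //.
- exact: measurable_funepos.
- exact: measurable_funeneg.
Qed.

(** The bound covers every x, including those with an infinite normalizer, because scores are
    required to be bounded everywhere. *)
Lemma cond_mean_bounded (h : R -> 'cV[R]_q) (B : R) x i :
  measurable_vec (T := measurableTypeR R) h -> (forall y i, `|h y i 0| <= B) ->
  `|cond_mean nu beta0 g0 h x i 0| <= B.
Proof.
move=> mh hB; have [dg _ _] := truth; have [mg g00 _] := dg; rewrite mxE.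
have mf := measurable_cond_density_y nu beta0 x mg.
have f0 y : 0 <= cond_density nu beta0 g0 y x by exact: cond_density_ge0.
have B0 : 0 <= B by exact: le_trans (normr_ge0 _) (hB 0 i).
have [fN|] := boolP (normalizer nu beta0 g0 x < +oo)%E.
  have f1 := cond_density_integral1 dg fN.
  by rewrite -[leRHS]mulr1; exact: (norm_bounded_mean mf f0 f1 mh hB).
(* [fine +oo] is 0, hence so is the conditional density. *)
rewrite -leNgt leye_eq => /eqP Ny.
under eq_Rintegral do rewrite /cond_density Ny invr0 !mulr0.
by rewrite /Rintegral integral0 normr0.
Qed.

(** * Submodels with a prescribed bounded score *)

(* Outside the ball of radius d the factor 1 + w^T h may be negative; the value
   g0 there keeps every member of the submodel a density. *)
Definition tilt_g (h : R -> 'cV[R]_q) (d : R) (w : 'cV[R]_q) (y : R) : R :=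
  if `|w| < d then
    g0 y * (1 + (w^T *m h y) 0 0) /
      (1 + (w^T *m \col_i \int[nu]_y (h y i 0 * g0 y)) 0 0)
  else g0 y.

(** The total mass stays 1 without a normalizing constant, as [alpha] will have mean 0 under [eta0].
    The cutoff at [d] is there to keep the factor positive. *)
Definition tilt_eta (alpha : covariate R q -> 'cV[R]_q) (d : R) (w : 'cV[R]_q)
    (x : covariate R q) : R :=
  if `|w| < d then eta0 x * (1 + (w^T *m alpha x) 0 0) else eta0 x.

Section bounded_perturbation.
Variable (B : R).
(** For coordinates bounded by [B] and |w| < d in the sup norm, |w^T v| <= M |w| <= 1/2. Every
    factor 1 + w^T v is then at least 1/2, and [tilt_ratio_bound] applies. *)
Let M := q%:R * B.
Let d := (2 * (M + 1))^-1.
Hypothesis B0 : 0 <= B.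

Let M0 : 0 <= M. Proof. by rewrite mulr_ge0. Qed.
Let d0 : 0 < d. Proof. by rewrite invr_gt0 mulr_gt0// ltr_wpDl. Qed.

Let dot_small (w v : 'cV[R]_q) : (forall i, `|v i 0| <= B) -> `|w| < d ->
  `|(w^T *m v) 0 0| <= 2^-1.
Proof.
move=> vB wd; apply: (le_trans (norm_dot_le w vB)).
have dE : d * (2 * (M + 1)) = 1 by rewrite mulVf// gt_eqF// mulr_gt0// ltr_wpDl.
have := normr_ge0 w; rewrite -/M; nra.
Qed.

Let tilt_gt0 (w v : 'cV[R]_q) : (forall i, `|v i 0| <= B) -> `|w| < d ->
  0 < 1 + (w^T *m v) 0 0.
Proof. by move=> vB wd; have := dot_small vB wd; rewrite ler_norml; lra. Qed.

Section tilt_g.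
Variable h : R -> 'cV[R]_q.
Hypotheses (mh : measurable_vec (T := measurableTypeR R) h)
  (hB : forall y i, `|h y i 0| <= B).

Let kB i : `|(\col_i \int[nu]_y (h y i 0 * g0 y)) i 0| <= B.
Proof.
have [[mg g00 g01] _ _] := truth; rewrite mxE -[leRHS]mulr1.
exact: (norm_bounded_mean mg g00 g01 mh hB).
Qed.

Let mB x i : `|cond_mean nu beta0 g0 h x i 0| <= B.
Proof. exact: cond_mean_bounded. Qed.

Let mwh (w : 'cV[R]_q) : measurable_fun [set: measurableTypeR R] (fun y => (w^T *m h y) 0 0).
Proof. exact: (measurable_vec_mulmx w^T mh 0). Qed.

Lemma tilt_g_density w : is_density nu (tilt_g h d w).
Proof.
have [dg _ _] := truth; have [mg g00 g01] := dg; rewrite /tilt_g.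
have [wd|//] := boolP (`|w| < d); set c := 1 + _; have c0 : 0 < c by exact: tilt_gt0.
split.
- by apply: measurable_funM => //; apply: measurable_funM => //; exact: measurable_funD.
- by move=> y; rewrite divr_ge0 ?(ltW c0)// mulr_ge0// ltW// tilt_gt0.
- under eq_integral do rewrite EFinM.
  rewrite ge0_integralZr//; last 3 first.
  + apply/measurable_EFinP; apply: measurable_funM => //; exact: measurable_funD.
  + by move=> y _; rewrite lee_fin mulr_ge0// ltW// tilt_gt0.
  + by rewrite lee_fin invr_ge0 ltW.
  by rewrite (tilt_integral mg g00 g01 mh hB) -EFinM divff// gt_eqF.
Qed.

Lemma tilt_g_normalizer w x : (normalizer nu beta0 g0 x < +oo)%E -> `|w| < d ->
  normalizer nu beta0 (tilt_g h d w) x =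
  (fine (normalizer nu beta0 g0 x) * (1 + (w^T *m cond_mean nu beta0 g0 h x) 0 0)
    / (1 + (w^T *m \col_i \int[nu]_y (h y i 0 * g0 y)) 0 0))%:E.
Proof.
move=> fN wd; have [dg _ _] := truth; have [mg g00 _] := dg.
rewrite /tilt_g wd; set c := 1 + _; have c0 : 0 < c by exact: tilt_gt0.
have N0 := normalizer_gt0 beta0 x dg.
set n := fine _; have n0 : 0 < n by rewrite fine_gt0// N0.
have mf := measurable_cond_density_y nu beta0 x mg.
have f0 y : 0 <= cond_density nu beta0 g0 y x by exact: cond_density_ge0.
have f1 := cond_density_integral1 dg fN.
transitivity (\int[nu]_y ((n / c)%:E *
    (cond_density nu beta0 g0 y x * (1 + (w^T *m h y) 0 0))%:E))%E.
  apply: eq_integral => y _; rewrite -EFinM; congr EFin.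
  by rewrite /cond_density -/n; field; rewrite !gt_eqF.
rewrite ge0_integralZl//; last 3 first.
- apply/measurable_EFinP; apply: measurable_funM => //; exact: measurable_funD.
- by move=> y _; rewrite lee_fin mulr_ge0// ltW// tilt_gt0.
- by rewrite lee_fin divr_ge0// ltW.
rewrite (tilt_integral mf f0 f1 mh hB) -EFinM; congr EFin.
by rewrite mulrAC.
Qed.

(** The normalizing constant of the tilt cancels between numerator and normalizer. What remains is a
    ratio whose linear part in [w] is w^T (h(y) - E{h(Y) | X = x}): this is where the centring comes
    from. *)
Lemma tilt_g_cond_density w x y : (normalizer nu beta0 g0 x < +oo)%E -> `|w| < d ->
  cond_density nu beta0 (tilt_g h d w) y x = cond_density nu beta0 g0 y x *
    ((1 + (w^T *m h y) 0 0) / (1 + (w^T *m cond_mean nu beta0 g0 h x) 0 0)).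
Proof.
move=> fN wd; have [dg _ _] := truth.
rewrite {1}/cond_density tilt_g_normalizer// /tilt_g wd /=.
set c := 1 + (w^T *m \col_i _) 0 0; have c0 : 0 < c by exact: tilt_gt0.
have N0 := normalizer_gt0 beta0 x dg.
set m := 1 + (w^T *m cond_mean _ _ _ _ _) 0 0; have m0 : 0 < m by exact: tilt_gt0.
rewrite /cond_density; set n := fine _; have n0 : 0 < n by rewrite fine_gt0// N0.
by field; rewrite !gt_eqF.
Qed.

Lemma tilt_g_in_model w : in_model nu mu beta0 (tilt_g h d w) eta0.
Proof.
have [_ de fN] := truth; split => //; first exact: tilt_g_density.
apply: filterS fN => x fN ex; have {}fN := fN ex.
have [wd|wd] := boolP (`|w| < d); first by rewrite tilt_g_normalizer// ltry.
by rewrite /tilt_g (negbTE wd).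
Qed.

(** The exceptional set consists of the x with [eta0 x != 0] and an infinite normalizer; it does not
    depend on [w]. *)
Lemma tilt_g_linear : {ae (nu \x mu)%E, forall z, forall w, `|w| < d ->
  `|joint_density nu beta0 (tilt_g h d w) eta0 z -
    p0 z * (1 + (w^T *m (h z.1 - cond_mean nu beta0 g0 h z.2)) 0 0)| <=
  (4 * M ^+ 2) * `|w| ^+ 2 * p0 z}.
Proof.
have [_ _ /(product_ae_snd nu) fN] := truth.
apply: filterS fN => z fN w wd.
have [ez|ez] := eqVneq (eta0 z.2) 0.
  by rewrite /joint_density ez !mulr0 mul0r subr0 normr0.
rewrite {1}/joint_density tilt_g_cond_density ?fN//.
have -> : (w^T *m (h z.1 - cond_mean nu beta0 g0 h z.2)) 0 0 =
    (w^T *m h z.1) 0 0 - (w^T *m cond_mean nu beta0 g0 h z.2) 0 0.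
  by rewrite mulmxBr mxE [X in _ + X]mxE.
set u := (w^T *m h z.1) 0 0; set v := (w^T *m _) 0 0.
have -> : cond_density nu beta0 g0 z.1 z.2 * ((1 + u) / (1 + v)) * eta0 z.2 -
    p0 z * (1 + (u - v)) = p0 z * ((1 + u) / (1 + v) - (1 + (u - v))).
  by rewrite /joint_density; ring.
rewrite normrM ger0_norm// mulrC ler_wpM2r//.
have v2 : `|v| <= 2^-1 by apply: dot_small => //; exact: mB.
apply: (le_trans (tilt_ratio_bound u v2)).
have uM : `|u| <= M * `|w| by apply: norm_dot_le; exact: hB.
have vM : `|v| <= M * `|w| by apply: norm_dot_le => i; exact: mB.
have -> : 4 * M ^+ 2 * `|w| ^+ 2 = 2 * ((M * `|w| + M * `|w|) * (M * `|w|)) by ring.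
by rewrite ler_pM2l//; apply: ler_pM => //; exact: lerD.
Qed.

Lemma bounded_nuisance_score_g :
  nuisance_scores_g nu mu P beta0 g0 eta0
    (fun z => h z.1 - cond_mean nu beta0 g0 h z.2).
Proof.
pose b (z : observation R q) := h z.1 - cond_mean nu beta0 g0 h z.2.
have mb : measurable_vec b.
  apply: measurable_vecB => i; first exact: (measurableT_comp (mh i) measurable_fst).
  exact: (measurableT_comp (measurable_cond_mean mh i) measurable_snd).
have bB z i : `|b z i 0| <= 2 * B.
  rewrite !mxE; apply: (le_trans (ler_normB _ _)).
  have := hB z.1 i; have := mB z.2 i; rewrite !mxE; lra.
pose p w := joint_density nu beta0 (tilt_g h d w) eta0.
have mp w : measurable_fun setT (p w).
  have [[mg g_ge0 _] [me _ _] _] := tilt_g_in_model w.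
  exact: measurable_joint_density.
have p_ge0 w z : 0 <= p w z.
  have [[_ g_ge0 _] [_ e_ge0 _] _] := tilt_g_in_model w.
  exact: joint_density_ge0.
have tilt0 : tilt_g h d 0 = g0.
  apply/funext => y; rewrite /tilt_g normr0 d0 trmx0 !mul0mx !mxE addr0.
  by rewrite mulr1 divr1.
have pE : p 0 = p0 by rewrite /p tilt0.
have K0 : 0 <= 4 * M ^+ 2 by rewrite mulr_ge0 ?sqr_ge0.
have [r [C [D [reg bCD]]]] :=
  regular_reparametrization mb bB mp p_ge0 pE K0 d0 tilt_g_linear.
have sub : submodel_g nu mu P beta0 g0 eta0
    (fun gamma : 'cV[R]_r => tilt_g h d (D^T *m gamma)) 0 (fun z => D *m b z).
  split => //; last by rewrite mulmx0.
  by move=> gamma; exact: tilt_g_in_model.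
split; last by exists r, (fun gamma => tilt_g h d (D^T *m gamma)), 0, (fun z => D *m b z), C.
split => //; first by rewrite innerE; exact: (l2norm2_bounded mb bB).
move=> i; rewrite unlock.
(* Mean 0 is the conditional mean 0 of scores, read on the whole space. *)
have := score_combination_cond_mean0 i mb sub bCD measurableT.
by rewrite preimage_setT.
Qed.

End tilt_g.

Section tilt_eta.
Variable alpha : covariate R q -> 'cV[R]_q.
Hypotheses (ma : measurable_vec alpha) (aB : forall x i, `|alpha x i 0| <= B).
Hypothesis a0 : forall i, ('E_P[(fun z => alpha z.2 i 0)%R] = 0)%E.

Let a0_eta : \col_i \int[mu]_x (alpha x i 0 * eta0 x) = 0.
Proof.
have [dg [me e0 e1] fN] := truth.
apply/matrixP => i j; rewrite !mxE.
have ei := density_integrable me e0 e1.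
have ai := bounded_mul_density_integrable me e0 e1 ma aB i.
have aP : P.-integrable setT (fun z => (alpha z.2 i 0)%:E).
  apply: (@l2_integrable _ _ _ _ P (fun z => alpha z.2)).
    by move=> k; exact: (measurableT_comp (ma k) measurable_snd).
  apply: l2norm2_bounded => [k|z]; last exact: aB.
  exact: (measurableT_comp (ma k) measurable_snd).
(* Adding [B] makes the function nonnegative, as the marginal formula requires; the constant cancels
   at the end. *)
have aB0 x : 0 <= alpha x i 0 + B by have := aB x i; rewrite ler_norml; lra.
have maB : measurable_fun setT (fun x => alpha x i 0 + B).
  by apply: measurable_funD => //; exact: ma.
have cP : P.-integrable setT (fun=> B%:E) by exact: finite_measure_integrable_cst.
have cI : (\int[P]__ B%:E = B%:E)%E.
  rewrite integral_cst// -[RHS]mule1; congr (_ * _)%E; exact: probability_setT.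
have : (\int[P]_z (alpha z.2 i 0 + B)%:E = \int[mu]_x ((alpha x i 0 + B) * eta0 x)%:E)%E.
  rewrite -(joint_density_marginal truth maB aB0) P_integral//.
  exact: (measurableT_comp maB measurable_snd).
under eq_integral do rewrite EFinD.
rewrite (integralD measurableT aP cP).
have := a0 i; rewrite unlock => ->; rewrite add0e cI.
under eq_integral do rewrite mulrDl EFinD.
rewrite (integralD measurableT ai); last first.
  exact: (integrableZl measurableT B ei).
under [X in (_ + X)%E]eq_integral do rewrite EFinM.
rewrite (integralZl measurableT ei).
rewrite [X in (_ + _ * X)%E]e1 mule1 -[X in (X + _)%E]fineK; last first.
  exact: (integrable_fin_num measurableT ai).
by rewrite -EFinD => -[] /esym/(canRL (addrK _)); rewrite subrr.
Qed.

Let mwa (w : 'cV[R]_q) : measurable_fun setT (fun x => (w^T *m alpha x) 0 0).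
Proof. exact: (measurable_vec_mulmx w^T ma 0). Qed.

Lemma tilt_eta_in_model w : in_model nu mu beta0 g0 (tilt_eta alpha d w).
Proof.
have [dg de fN] := truth; have [me e0 e1] := de; split => //; rewrite /tilt_eta.
- have [wd|//] := boolP (`|w| < d); split.
  + by apply: measurable_funM => //; exact: measurable_funD.
  + by move=> x; rewrite mulr_ge0// ltW// tilt_gt0.
  + by rewrite (tilt_integral me e0 e1 ma aB) a0_eta mulmx0 mxE addr0.
- apply: filterS fN => x fN; case: ifPn => // wd; rewrite mulf_eq0 negb_or.
  by move=> /andP[ex _]; exact: fN.
Qed.

Lemma bounded_nuisance_score_eta :
  nuisance_scores_eta nu mu P beta0 g0 eta0 (fun z => alpha z.2).
Proof.
have [[mg g00 _] _ _] := truth.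
pose b (z : observation R q) := alpha z.2.
have mb : measurable_vec b by move=> i; exact: (measurableT_comp (ma i) measurable_snd).
have bB z i : `|b z i 0| <= B by exact: aB.
pose p w := joint_density nu beta0 g0 (tilt_eta alpha d w).
have mp w : measurable_fun setT (p w).
  by have [_ [me _ _] _] := tilt_eta_in_model w; exact: measurable_joint_density.
have p_ge0 w z : 0 <= p w z.
  by have [_ [_ e_ge0 _] _] := tilt_eta_in_model w; exact: joint_density_ge0.
have tilt0 : tilt_eta alpha d 0 = eta0.
  by apply/funext => x; rewrite /tilt_eta normr0 d0 trmx0 mul0mx mxE addr0 mulr1.
have pE : p 0 = p0 by rewrite /p tilt0.
have plin : {ae (nu \x mu)%E, forall z, forall w, `|w| < d ->
    `|p w z - p0 z * (1 + (w^T *m b z) 0 0)| <= 0 * `|w| ^+ 2 * p0 z}.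
  apply: aeW => z w wd; rewrite /p /joint_density /tilt_eta wd.
  by rewrite mulrA subrr normr0 !mul0r.
have [r [C [D [reg bCD]]]] :=
  regular_reparametrization mb bB mp p_ge0 pE (lexx 0) d0 plin.
split; last first.
  exists r, (fun gamma => tilt_eta alpha d (D^T *m gamma)), 0, (fun z => D *m b z), C.
  split => //; split => //; last by rewrite mulmx0.
  by move=> gamma; exact: tilt_eta_in_model.
by split => //; rewrite innerE; exact: (l2norm2_bounded mb bB).
Qed.

End tilt_eta.

End bounded_perturbation.

(** * Approximation of square-integrable elements by bounded scores *)

Lemma P_integral_sqr_le (u v : observation R q -> R) :
  measurable_fun setT u -> measurable_fun setT v ->
  {ae mu, forall x, eta0 x != 0 ->
    (\int[nu]_y (u (y, x) ^+ 2 * cond_density nu beta0 g0 y x)%:E <=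
     \int[nu]_y (v (y, x) ^+ 2 * cond_density nu beta0 g0 y x)%:E)%E} ->
  (\int[P]_z (u z ^+ 2)%:E <= \int[P]_z (v z ^+ 2)%:E)%E.
Proof.
have [[mg g00 _] [_ e00 _] _] := truth.
have sq0 (f : observation R q -> R) z : 0 <= f z ^+ 2 * p0 z.
  by rewrite mulr_ge0 ?sqr_ge0.
have msq (f : observation R q -> R) : measurable_fun setT f ->
    measurable_fun setT (fun x => \int[nu]_y (f (y, x) ^+ 2 * p0 (y, x))%:E)%E.
  move=> mf; pose F (z : observation R q) := (f z ^+ 2 * p0 z)%:E.
  apply: (measurable_fun_fubini_tonelli_G (m1 := nu) F).
    by apply/measurable_EFinP; apply: measurable_funM => //; exact: measurable_funX.
  by move=> z; rewrite lee_fin; exact: sq0.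
move=> mu' mv uv.
rewrite (P_integral_iter (measurable_funX 2 mu') (fun z => sqr_ge0 (u z))).
rewrite (P_integral_iter (measurable_funX 2 mv) (fun z => sqr_ge0 (v z))).
apply: ae_ge0_le_integral => //.
- by move=> x _; apply: integral_ge0 => y _; rewrite lee_fin; exact: sq0.
- exact: msq.
- by move=> x _; apply: integral_ge0 => y _; rewrite lee_fin; exact: sq0.
- exact: msq.
apply: filterS uv => x uvx _.
have [ex|ex] := eqVneq (eta0 x) 0.
  by rewrite !integral0_eq// => y _; rewrite /joint_density ex !mulr0.
have mfx (f : observation R q -> R) : measurable_fun setT f ->
    measurable_fun setT (fun y => (f (y, x) ^+ 2 * cond_density nu beta0 g0 y x)%:E).
  move=> mf; apply/measurable_EFinP; apply: measurable_funM.
    exact: measurable_funX (measurableT_comp mf (pair2_measurable x)).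
  exact: measurable_cond_density_y.
have pE (f : observation R q -> R) : measurable_fun setT f ->
    (\int[nu]_y (f (y, x) ^+ 2 * p0 (y, x))%:E =
     (eta0 x)%:E * \int[nu]_y (f (y, x) ^+ 2 * cond_density nu beta0 g0 y x)%:E)%E.
  move=> mf; rewrite -ge0_integralZl ?lee_fin//; last 2 first.
  - exact: mfx.
  - by move=> y _; rewrite lee_fin mulr_ge0 ?sqr_ge0// cond_density_ge0.
  by apply: eq_integral => y _; rewrite -EFinM /joint_density/= [in RHS]mulrC mulrA.
by rewrite !pE//; apply: lee_wpmul2l; rewrite ?lee_fin// uvx.
Qed.

Lemma Lambda1_sup a (h : R -> 'cV[R]_q) : hilbert P a ->
  measurable_vec (T := measurableTypeR R) h ->
  {ae P, forall z, cond_integrable nu beta0 g0 h z.2} ->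
  {ae P, forall z, a z = h z.1 - cond_mean nu beta0 g0 h z.2} ->
  Lambda1 nu mu P beta0 g0 eta0 a.
Proof.
move=> Ha mh hint aE; split=> // e e0; have [ma afin _] := Ha.
have [dg [me et0 _] fN] := truth; have [mg g00 _] := dg.
pose m := cond_mean nu beta0 g0 h.
have mm : measurable_vec m by exact: measurable_cond_mean.
have mh1 i : measurable_fun setT (fun z : observation R q => h z.1 i 0).
  exact: (measurableT_comp (mh i) measurable_fst).
have mm2 i : measurable_fun setT (fun z : observation R q => m z.2 i 0).
  exact: (measurableT_comp (mm i) measurable_snd).
pose w (z : observation R q) : 'cV[R]_q := h z.1 - m z.2.
have mw : measurable_vec w.
  by apply: measurable_vecB => i; [exact: mh1|exact: mm2].
have wfin : (l2norm2 P w < +oo)%E.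
  have -> : l2norm2 P w = l2norm2 P a; last by rewrite -innerE.
  apply: ae_eq_integral => //.
  - by apply/measurable_EFinP; exact: measurable_sumsq.
  - by apply/measurable_EFinP; exact: measurable_sumsq.
  - by apply: filterS aE => z -> _.
pose psi n t : R := t - truncate n%:R t.
have mpsi n (f : observation R q -> R) :
    measurable_fun setT f -> measurable_fun setT (fun t => psi n (f t)).
  by move=> mf; apply: measurable_funB => //; exact: measurable_truncate.
(* A majorant in norm of the approximation error rather than the error itself: unlike psi_n(h(Y))
   alone, it is dominated by the square-integrable [w]. *)
pose G n (z : observation R q) : 'cV[R]_q :=
  \col_i (psi n (h z.1 i 0) - psi n (m z.2 i 0)).
have mG n : measurable_vec (G n).
  by move=> i; under eq_fun do rewrite mxE; apply: measurable_funB; exact: mpsi.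
have Gw n z i : `|G n z i 0| <= `|w z i 0|.
  by rewrite !mxE; exact: truncation_error_lipschitz.
have Gcv z i : G n z i 0 @[n --> \oo] --> 0.
  have -> : (fun n => G n z i 0) =
      (fun n => psi n (h z.1 i 0) - psi n (m z.2 i 0)).
    by apply/funext => n; rewrite mxE.
  have := cvgB (truncation_error_cvg (h z.1 i 0)) (truncation_error_cvg (m z.2 i 0)).
  by rewrite subrr; apply.
have [n Gn] := l2_dominated mw wfin mG Gw Gcv e0.
pose hn (y : measurableTypeR R) : 'cV[R]_q := \col_i truncate n%:R (h y i 0).
have mhn : measurable_vec hn.
  by move=> i; under eq_fun do rewrite mxE; exact: measurable_truncate.
have hnB y i : `|hn y i 0| <= n%:R by rewrite mxE; exact: truncate_bounded.
exists (fun z => hn z.1 - cond_mean nu beta0 g0 hn z.2).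
  exact: (bounded_nuisance_score_g (ler0n _ n) mhn hnB).
apply: le_lt_trans Gn; rewrite innerE.
have mmn := measurable_cond_mean mhn.
pose b (z : observation R q) : 'cV[R]_q := hn z.1 - cond_mean nu beta0 g0 hn z.2.
have mb : measurable_vec b.
  apply: measurable_vecB => i; first exact: (measurableT_comp (mhn i) measurable_fst).
  exact: (measurableT_comp (mmn i) measurable_snd).
apply: l2norm2_le => // [|i]; first exact: measurable_vecB.
(* This is a.e. the i-th coordinate of a - b: the truncation error of h(Y), minus its own
   conditional mean. *)
pose D (z : observation R q) :=
  psi n (h z.1 i 0) - (m z.2 i 0 - cond_mean nu beta0 g0 hn z.2 i 0).
have mD : measurable_fun setT D.
  apply: measurable_funB; first exact: mpsi.
  by apply: measurable_funB => //; exact: (measurableT_comp (mmn i) measurable_snd).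
have -> : (\int[P]_z (((a z - b z) i 0) ^+ 2)%:E = \int[P]_z ((D z) ^+ 2)%:E)%E.
  apply: ae_eq_integral => //.
  - by apply/measurable_EFinP; apply: measurable_funX; exact: measurable_vecB.
  - by apply/measurable_EFinP; exact: measurable_funX.
  - apply: filterS aE => z az _; congr (_ ^+ 2)%:E.
    by rewrite az /D /psi /b /m !mxE; ring.
apply: P_integral_sqr_le => //; first exact: mG.
have := ae_P_sndE hint; apply: filterS2 fN => x fN hx ex.
have phi1 := cond_density_integral1 dg (fN ex).
have := truncation_variance_le (psi n (m x i 0)) (ler0n _ n)
  (measurable_cond_density_y nu beta0 x mg)
  (fun y => cond_density_ge0 nu beta0 y x g00) phi1 (mh i) (hx ex i).
have -> : \int[nu]_y (truncate n%:R (h y i 0) * cond_density nu beta0 g0 y x) =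
    cond_mean nu beta0 g0 hn x i 0.
  by rewrite mxE; apply: eq_Rintegral => y _; rewrite mxE.
have -> : \int[nu]_y (h y i 0 * cond_density nu beta0 g0 y x) = m x i 0.
  by rewrite mxE.
move=> le_var.
have GE y : G n (y, x) i 0 = psi n (h y i 0) - psi n (m x i 0) by rewrite mxE.
by under [leRHS]eq_integral do rewrite GE.
Qed.

Lemma Lambda2_sup a (alpha : covariate R q -> 'cV[R]_q) : hilbert P a ->
  measurable_vec alpha ->
  (forall i, ('E_P[(fun z => alpha z.2 i 0)%R] = 0)%E) ->
  {ae P, forall z, a z = alpha z.2} ->
  Lambda2 nu mu P beta0 g0 eta0 a.
Proof.
move=> Ha malpha alpha0 aE; split=> // e e0; have [ma afin _] := Ha.
pose w (z : observation R q) : 'cV[R]_q := alpha z.2.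
have mw : measurable_vec w.
  by move=> i; exact: (measurableT_comp (malpha i) measurable_snd).
have wfin : (l2norm2 P w < +oo)%E.
  have -> : l2norm2 P w = l2norm2 P a; last by rewrite -innerE.
  apply: ae_eq_integral => //.
  - by apply/measurable_EFinP; exact: measurable_sumsq.
  - by apply/measurable_EFinP; exact: measurable_sumsq.
  - by apply: filterS aE => z -> _.
pose G n (z : observation R q) : 'cV[R]_q :=
  \col_i (w z i 0 - truncate n%:R (w z i 0)).
have mG n : measurable_vec (G n).
  move=> i; under eq_fun do rewrite mxE.
  by apply: measurable_funB; [exact: mw|exact: (measurable_truncate n%:R (mw i))].
have Gw n z i : `|G n z i 0| <= `|w z i 0|.
  by rewrite mxE; exact: truncation_error_le.
have Gcv z i : G n z i 0 @[n --> \oo] --> 0.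
  rewrite (_ : (fun n => _) = (fun n => w z i 0 - truncate n%:R (w z i 0))).
    exact: truncation_error_cvg.
  by apply/funext => n; rewrite mxE.
have [n Gn] := l2_dominated mw wfin mG Gw Gcv e0.
have intc (c : R) : (\int[P]__ c%:E = c%:E)%E.
  by rewrite integral_cst// -[RHS]mule1; congr (_ * _)%E; exact: probability_setT.
(* With the constant density 1, the lemmas on densities apply to P itself. *)
pose one : observation R q -> R := cst 1.
have one1 : (\int[P]_z (one z)%:E = 1)%E by exact: intc.
have mone : measurable_fun setT one by exact: measurable_cst.
have one0 z : 0 <= one z by exact: ler01.
pose tw (z : observation R q) : 'cV[R]_q := \col_i truncate n%:R (w z i 0).
have mtw : measurable_vec tw.
  by move=> i; under eq_fun do rewrite mxE; exact: (measurable_truncate n%:R (mw i)).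
have twB z i : `|tw z i 0| <= n%:R by rewrite mxE; exact: truncate_bounded.
pose kappa i := \int[P]_z (tw z i 0 * one z).
have kappa_le i : `|kappa i| <= n%:R.
  by rewrite -[leRHS]mulr1; exact: (norm_bounded_mean mone one0 one1 mtw twB).
(* Truncation may shift the mean, so the truncated function is recentred by [kappa], itself at most
   n; hence the bound n + n. *)
pose an (x : covariate R q) : 'cV[R]_q := \col_i (truncate n%:R (alpha x i 0) - kappa i).
have man : measurable_vec an.
  move=> i; under eq_fun do rewrite mxE.
  by apply: measurable_funB => //; exact: (measurable_truncate n%:R (malpha i)).
have anB x i : `|an x i 0| <= n%:R + n%:R.
  rewrite mxE; apply: (le_trans (ler_normB _ _)); apply: lerD => //.
  exact: truncate_bounded.
have an0 i : ('E_P[(fun z : observation R q => an z.2 i 0)%R] = 0)%E.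
  have twi := bounded_mul_density_integrable mone one0 one1 mtw twB i.
  rewrite unlock (_ : (fun z => _) = fun z => (tw z i 0 * one z)%:E - (kappa i)%:E)%E.
    rewrite (integralB measurableT twi); last exact: finite_measure_integrable_cst.
    rewrite intc -[X in (X - _)%E]fineK ?subee//.
    exact: (integrable_fin_num measurableT twi).
  by apply/funext => z; rewrite !mxE mulr1 EFinB.
exists (fun z => an z.2).
  by apply: (bounded_nuisance_score_eta _ man anB an0); rewrite addr_ge0.
apply: le_lt_trans Gn; rewrite innerE.
have mb : measurable_vec (fun z : observation R q => an z.2).
  by move=> i; exact: (measurableT_comp (man i) measurable_snd).
apply: l2norm2_le => // [|i]; first exact: measurable_vecB.
have wi : P.-integrable setT (fun z => (w z i 0 * one z)%:E).
  by under eq_fun do rewrite mulr1; exact: l2_integrable.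
have w0 : \int[P]_z (w z i 0 * one z) = 0.
  under eq_Rintegral do rewrite mulr1.
  by have := alpha0 i; rewrite unlock /Rintegral => ->.
(* As [w] has mean 0, the error is the truncation error centred at its mean; comparison with the
   constant 0 bounds it by the uncentred error [G n]. *)
have := truncation_variance_le 0 (ler0n _ n) mone one0 one1 (mw i) wi.
have -> : \int[P]_z (truncate n%:R (w z i 0) * one z) = kappa i.
  by apply: eq_Rintegral => z _; rewrite mxE.
rewrite w0; under eq_integral do rewrite mulr1.
under [X in (_ <= X)%E -> _]eq_integral do rewrite mulr1 subr0.
have GE z : G n z i 0 = w z i 0 - truncate n%:R (w z i 0) by rewrite mxE.
move=> le_var; under [leRHS]eq_integral do rewrite GE.
apply: le_trans le_var; rewrite le_eqVlt; apply/orP; left; apply/eqP.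
apply: ae_eq_integral => //.
- by apply/measurable_EFinP; apply: measurable_funX; exact: measurable_vecB.
- apply/measurable_EFinP; apply: measurable_funX; apply: measurable_funB => //.
  by apply: measurable_funB; [exact: mw|exact: (measurable_truncate n%:R (mw i))].
- apply: filterS aE => z az _; congr (_ ^+ 2)%:E.
  by rewrite az !mxE /w; ring.
Qed.

End truth.

Theorem lemma1 (R : realType) (q : nat)
    (nu : {sigma_finite_measure set (measurableTypeR R) -> \bar R})
    (mu : {sigma_finite_measure set (covariate R q) -> \bar R})
    (beta0 : 'cV[R]_q) (g0 : R -> R) (eta0 : covariate R q -> R)
    (P : probability (observation R q) R)
    (truth_in_model : in_model nu mu beta0 g0 eta0)
    (P_truth : has_density nu mu P (joint_density nu beta0 g0 eta0))
    (model_regular : regular_model nu mu P beta0 g0 eta0) :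
  Lambda1 nu mu P beta0 g0 eta0 =
    [set a | hilbert P a /\
       exists h : R -> 'cV[R]_q,
         [/\ measurable_vec (T := measurableTypeR R) h,
             {ae P, forall z, cond_integrable nu beta0 g0 h z.2} &
             {ae P, forall z, a z = h z.1 - cond_mean nu beta0 g0 h z.2}]]
  /\
  Lambda2 nu mu P beta0 g0 eta0 =
    [set a | hilbert P a /\
       exists alpha : covariate R q -> 'cV[R]_q,
         [/\ measurable_vec alpha,
             (forall i, ('E_P[(fun z => alpha z.2 i 0)%R] = 0)%E) &
             {ae P, forall z, a z = alpha z.2}]].
Proof.
split; apply/seteqP; split => a.
- by move=> La; have [Ha _] := La; split=> //; exact: Lambda1_sub La.
- by move=> [Ha [h [mh hint aE]]]; exact: Lambda1_sup Ha mh hint aE.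
- by move=> La; have [Ha _] := La; split=> //; exact: Lambda2_sub La.
- by move=> [Ha [alpha [malpha alpha0 aE]]]; exact: Lambda2_sup Ha malpha alpha0 aE.
Qed.
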